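(* Let $A\in\mathcal{M}_d(\mathbb{C})$ be self-adjoint and let $\mathcal{X},\mathcal{Y}\subset\mathbb{C}^d$ be subspaces with $\dim\mathcal{X}=\dim\mathcal{Y}=k$. Let $Y\in\mathcal{M}_{d,k}(\mathbb{C})$ have columns forming an orthonormal basis of $\mathcal{Y}$, and let $R_Y=AY-Y(Y^*AY)$. Let $p=\dim(\mathcal{X}+\mathcal{Y})$, let $S\in\mathcal{M}_{d,p}(\mathbb{C})$ be such that its columns form an orthonormal basis of $\mathcal{X}+\mathcal{Y}$, and let $A_{\mathcal{X}+\mathcal{Y}}=S^*AS\in\mathcal{M}_p(\mathbb{C})$. Then: 1. If $\delta>0$ is such that $(A,\mathcal{X},\mathcal{Y},\delta)$ satisfies the DKN separation property, then there exists $\delta'\ge\delta$ such that $(A_{\mathcal{X}+\mathcal{Y}},S^*\mathcal{X},S^*\mathcal{Y},\delta')$ satisfies the DKN separation property. 2. If $\delta'>0$ is such that $(A_{\mathcal{X}+\mathcal{Y}},S^*\mathcal{X},S^*\mathcal{Y},\delta')$ satisfies the DKN separation property, then $$\delta'\,\|\tan(\Theta(\mathcal{X},\mathcal{Y}))\|\le\|A_{\mathcal{X}+\mathcal{Y}}Y_S-Y_S(Y_S^*A_{\mathcal{X}+\mathcal{Y}}Y_S)\|=\|P_{\mathcal{X}+\mathcal{Y}}R_Y\|$$ for every unitarily invariant norm $\|\cdot\|$, where $Y_S=S^*Y\in\mathcal{M}_{p,k}(\mathbb{C})$.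
   Context: $\mathcal{M}_{m,n}(\mathbb{C})$ is the space of complex $m\times n$ matrices and $\mathcal{M}_n(\mathbb{C})=\mathcal{M}_{n,n}(\mathbb{C})$. $P_{\mathcal{Z}}$ is the orthogonal projection onto $\mathcal{Z}$. For a self-adjoint matrix $C$, $\lambda_i(C)$ are its eigenvalues counted with multiplicity in non-increasing order. DKN (Davis-Kahan-Nakatsukasa) separation property: let $B\in\mathcal{M}_n(\mathbb{C})$ be self-adjoint, let $\mathcal{V},\mathcal{W}\subset\mathbb{C}^n$ be subspaces with $\dim\mathcal{V}=\dim\mathcal{W}=k$ and $\mathcal{V}$ $B$-invariant, let $V_\perp\in\mathcal{M}_{n,n-k}(\mathbb{C})$ have columns forming an orthonormal basis of $\mathcal{V}^\perp$ and let $W\in\mathcal{M}_{n,k}(\mathbb{C})$ have columns forming an orthonormal basis of $\mathcal{W}$. Given $\delta>0$, $(B,\mathcal{V},\mathcal{W},\delta)$ satisfies the DKN separation property if there exist real $a\le b$ such that (1) $\lambda_i(V_\perp^*BV_\perp)\in[a,b]$ for $1\le i\le n-k$, and (2) $\lambda_i(W^*BW)\in(-\infty,a-\delta]\cup[b+\delta,\infty)$ for $1\le i\le k$. (In particular the invariance of the first subspace is part of the property. The property implies, by a theorem of Nakatsukasa, that all principal angles between $\mathcal{V}$ and $\mathcal{W}$ are less than $\pi/2$.) The principal angles $\Theta(\mathcal{X},\mathcal{Y})=(\Theta_i)_{i=1}^k$, with $\pi/2\ge\Theta_1\ge\dots\ge\Theta_k\ge0$, are defined by $\cos(\Theta_{k-i+1})=s_i(X^*Y)$,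 where the columns of $X\in\mathcal{M}_{d,k}(\mathbb{C})$ form an orthonormal basis of $\mathcal{X}$ and $s_1\ge\dots\ge s_k$ are singular values; $\tan$ is applied entrywise. A norm on $\mathcal{M}_d(\mathbb{C})$ is unitarily invariant if $\|UBV\|=\|B\|$ for all $B\in\mathcal{M}_d(\mathbb{C})$ and unitary $U,V$. It is applied to smaller or rectangular matrices (with at most $d$ rows and columns) by padding with zeros to size $d\times d$, and to a vector $x\in\mathbb{R}^k$ as the norm of the diagonal matrix with main diagonal $x$ (padded with zeros). *)

(* Defs.v *)
From HB Require Import structures.
From mathcomp Require Import all_boot all_order all_algebra.
From mathcomp Require Import sesquilinear spectral.
From mathcomp Require Import all_classical all_reals all_analysis.
From mathcomp Require Import complex.

Set Implicit Arguments.
Unset Strict Implicit.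
Unset Printing Implicit Defensive.

Import Order.TTheory GRing.Theory Num.Theory.

Local Open Scope ring_scope.
Local Open Scope sesquilinear_scope.

Section Subspaces.
Variable R : realType.
Local Notation C := R[i].

(* Subspaces of C^n are spaces of column vectors (the library's orthov and
   proj_ortho work on row vectors), so that matrices act on the left. *)

Definition is_onb n k (Q : 'M[C]_(n, k)) (V : {vspace 'cV[C]_n}) : Prop :=
  Q ^t* *m Q = 1%:M /\ basis_of V [tuple col j Q | j < k].

Definition mximage m n (M : 'M[C]_(m, n)) (V : {vspace 'cV[C]_n}) :
  {vspace 'cV[C]_m} := (linfun (mulmx M) @: V)%VS.

Definition orthoc n (V : {vspace 'cV[C]_n}) : {vspace 'cV[C]_n} :=
  (\bigcap_(i < \dim V) lker (linfun (mulmx ((vbasis V)`_i ^t*))))%VS.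

Definition orthoproj n (V : {vspace 'cV[C]_n}) : 'M[C]_n :=
  \matrix_(i, j) daddv_pi V (orthoc V) (delta_mx j 0) i 0.

Lemma mem_mximage m n (M : 'M[C]_(m, n)) (V : {vspace 'cV[C]_n}) w :
  reflect (exists2 v, v \in V & w = M *m v) (w \in mximage M V).
Proof.
by apply: (iffP memv_imgP) => -[v vV ->]; exists v => //; rewrite lfunE.
Qed.

Lemma orthocP n (V : {vspace 'cV[C]_n}) v :
  reflect (forall u, u \in V -> u ^t* *m v = 0) (v \in orthoc V).
Proof.
apply: (iffP idP) => [|vV].
  rewrite memvE => /subv_bigcapP vP u /coord_vbasis ->.
  rewrite linear_sum raddf_sum mulmx_suml big1 // => i _.
  have := vP i isT; rewrite -memvE memv_ker lfunE /= => /eqP vi.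
  by rewrite linearZ /= map_mxZ -scalemxAl vi scaler0.
rewrite memvE; apply/subv_bigcapP => i _.
rewrite -memvE memv_ker lfunE /=; apply/eqP/vV/vbasis_mem.
by rewrite mem_nth // size_tuple.
Qed.

Lemma is_onb_dim n k (Q : 'M[C]_(n, k)) V : is_onb Q V -> \dim V = k.
Proof. by case=> _ /size_basis. Qed.

Lemma is_onb_mem n k (Q : 'M[C]_(n, k)) V v :
  is_onb Q V -> reflect (exists x, v = Q *m x) (v \in V).
Proof.
case=> _ /span_basis <-.
have tE (i : 'I_k) : [tuple col j Q | j < k]`_i = col i Q.
  by rewrite -tnth_nth tnth_mktuple.
apply: (iffP idP) => [/coord_span ->|[x ->]].
  exists (\col_i coord [tuple col j Q | j < k] i v).
  apply/colP => i; rewrite summxE mxE; apply: eq_bigr => j _.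
  by rewrite !mxE tE !mxE mulrC.
have -> : Q *m x = \sum_i x i 0 *: col i Q.
  apply/colP => i; rewrite summxE mxE; apply: eq_bigr => j _.
  by rewrite !mxE mulrC.
apply: memv_suml => i _; apply/memvZ/memv_span.
by apply/mapP; exists i; rewrite // mem_enum.
Qed.

Lemma is_onbP n k (Q : 'M[C]_(n, k)) (V : {vspace 'cV[C]_n}) :
  Q ^t* *m Q = 1%:M -> (forall v, v \in V <-> exists x, v = Q *m x) ->
  is_onb Q V.
Proof.
move=> QQ VQ; split=> //.
have tE (i : 'I_k) : [tuple col j Q | j < k]`_i = col i Q.
  by rewrite -tnth_nth tnth_mktuple.
have sumE (x : 'cV_k) : Q *m x = \sum_i x i 0 *: col i Q.
  apply/colP => i; rewrite summxE mxE; apply: eq_bigr => j _.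
  by rewrite !mxE mulrC.
apply/andP; split; last first.
  apply/freeP => c c0 i.
  have Qc0 : Q *m (\col_j c j) = 0.
    rewrite sumE -[RHS]c0; apply: eq_bigr => j _; by rewrite tE mxE.
  have : Q ^t* *m Q *m (\col_j c j) = 0 by rewrite -mulmxA Qc0 mulmx0.
  by rewrite QQ mul1mx => /colP/(_ i); rewrite !mxE.
rewrite eqEsubv; apply/andP; split.
  apply/span_subvP => _ /mapP[i _ ->]; apply/VQ; exists (delta_mx i 0).
  by rewrite colE.
apply/subvP => v /VQ[x ->]; rewrite sumE; apply: memv_suml => i _.
by apply/memvZ/memv_span/mapP; exists i; rewrite // mem_enum.
Qed.

Lemma orthoprojE n k (Q : 'M[C]_(n, k)) V :
  is_onb Q V -> orthoproj V = Q *m Q ^t*.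
Proof.
move=> QV; have QQ := QV.1.
have cap0 : (V :&: orthoc V = 0)%VS.
  apply/eqP; rewrite -subv0; apply/subvP => v; rewrite memv_cap memv0.
  case/andP => vV /orthocP vo; case/(is_onb_mem _ QV): (vV) => x vE.
  have := vo _ vV; rewrite {1}vE trmx_mul map_mxM -mulmxA.
  move: (vV) => _; have x0 : x = 0.
    apply/colP => i; have ci : Q *m delta_mx i 0 \in V.
      by apply/(is_onb_mem _ QV); exists (delta_mx i 0).
    have := vo _ ci; rewrite trmx_mul map_mxM -mulmxA vE (mulmxA _ Q) QQ mul1mx.
    rewrite trmx_delta map_delta_mx => /matrixP/(_ 0 0).
    by rewrite -rowE !mxE.
  by rewrite vE x0 mulmx0 eqxx.
apply/matrixP => i j; rewrite mxE.
set e : 'cV_n := delta_mx j 0.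
have eV : Q *m Q ^t* *m e \in V.
  by apply/(is_onb_mem _ QV); exists (Q ^t* *m e); rewrite mulmxA.
have eo : e - Q *m Q ^t* *m e \in orthoc V.
  apply/orthocP => u /(is_onb_mem _ QV)[x ->].
  rewrite trmx_mul map_mxM -mulmxA mulmxBr !mulmxA QQ mul1mx subrr.
  by rewrite mulmx0.
have -> : daddv_pi V (orthoc V) e = Q *m Q ^t* *m e.
  rewrite -{1}(subrK (Q *m Q ^t* *m e) e) linearD /= [X in _ + X]daddv_pi_id //.
  suff -> : daddv_pi V (orthoc V) (e - Q *m Q ^t* *m e) = 0 by rewrite add0r.
  have := @daddv_pi_add _ _ V (orthoc V) (e - Q *m Q ^t* *m e) cap0.
  rewrite (@daddv_pi_id _ _ (orthoc V)) //; last by rewrite capvC.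
  move=> /(_ (subvP (addvSr _ _) _ eo)) /(canRL (addrK _)) ->.
  by rewrite subrr.
by rewrite -colE mxE.
Qed.

Definition onb_of n k (V : {vspace 'cV[C]_n}) : 'M[C]_(n, k) :=
  xget 0 [set Q | is_onb Q V]%classic.

Lemma onb_ofP n k (V : {vspace 'cV[C]_n}) :
  \dim V = k -> is_onb (onb_of k V) V.
Proof.
move=> dV; subst k; set k := \dim V.
suff [Q QV] : exists Q : 'M[C]_(n, k), is_onb Q V.
  by rewrite /onb_of; case: xgetP => [Q0 _ //|/(_ Q)].
pose M : 'M[C]_(k, n) := \matrix_(i < k) ((vbasis V)`_i)^T.
have ME (x : 'rV_k) : (x *m M)^T = \sum_i x 0 i *: (vbasis V)`_i.
  apply/colP => i; rewrite summxE !mxE; apply: eq_bigr => j _.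
  by rewrite !mxE.
have Mfree : row_free M.
  apply/row_freeP; apply/row_freeP/inj_row_free => x xM.
  move: (basis_free (vbasisP V)) => /freeP fr.
  have := ME x; rewrite xM trmx0 => /esym/fr x0.
  by apply/rowP => i; rewrite x0 mxE.
have kn : (k <= n)%N by rewrite -(eqP Mfree) rank_leq_col.
have SM := eqmx_schmidt_free Mfree.
have Su := schmidt_unitarymx M kn.
exists (schmidt M)^T; apply: is_onbP.
  have /unitarymxP/(congr1 trmx) := Su.
  by rewrite trmx_mul trmx1 map_trmx.
move=> v; have -> : v \in V <-> exists x : 'rV_k, v = (x *m M)^T.
  split=> [/coord_vbasis ->|[x ->]].
    exists (\row_(i < k) coord (vbasis V) i v).
    by rewrite ME; apply: eq_bigr => i _; rewrite mxE.
  rewrite ME; apply: memv_suml => i _; apply/memvZ/vbasis_mem/mem_nth.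
  by rewrite size_tuple.
split=> -[x ->].
  have : (x *m M <= schmidt M)%MS by rewrite SM submxMl.
  by case/submxP => y ->; exists y^T; rewrite trmx_mul.
have : (x^T *m schmidt M <= M)%MS by rewrite -SM submxMl.
by case/submxP => y yE; exists y; rewrite -yE trmx_mul trmxK.
Qed.

End Subspaces.

Section Spectrum.
Variable R : realType.
Local Notation C := R[i].

(* 0-based, and meant for self-adjoint M, whose characteristic roots are real;
   `_i is 0 past the end of the list. *)
Definition lambda n (M : 'M[C]_n) (i : nat) : R :=
  (sort >=%R [seq complex.Re z
             | z <- sval (closed_field_poly_normal (char_poly M))])`_i.

Definition singular_value m n (M : 'M[C]_(m, n)) (i : nat) : R :=
  Num.sqrt (lambda (M ^t* *m M) i).

(* acos takes the values s_i of [0, 1] into [0, pi/2]. *)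
Definition principal_angle n k (X Y : {vspace 'cV[C]_n}) (i : 'I_k) : R :=
  acos (singular_value ((onb_of k X) ^t* *m onb_of k Y) (rev_ord i)).

Definition DKN_separation n k (B : 'M[C]_n) (V W : {vspace 'cV[C]_n}) (delta : R) : Prop :=
  [/\ B \is hermsymmx, \dim V = k, \dim W = k, (mximage B V <= V)%VS &
    forall (Vp : 'M[C]_(n, n - k)) (Wm : 'M[C]_(n, k)),
      is_onb Vp (orthoc V) -> is_onb Wm W ->
      exists a b : R, [/\ a <= b,
        forall i, (i < n - k)%N -> a <= lambda (Vp ^t* *m B *m Vp) i <= b &
        forall i, (i < k)%N -> lambda (Wm ^t* *m B *m Wm) i <= a - delta \/
                               b + delta <= lambda (Wm ^t* *m B *m Wm) i]].

End Spectrum.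

Section Norms.
Variable R : realType.
Local Notation C := R[i].

Definition unitarily_invariant_norm d (N : 'M[C]_d -> R) : Prop :=
  [/\ forall B, 0 <= N B,
      forall B, N B = 0 -> B = 0,
      forall (c : C) B, N (c *: B) = Normc.normc c * N B,
      forall B B', N (B + B') <= N B + N B' &
      forall U B V, U \is unitarymx -> V \is unitarymx ->
        N (U *m B *m V) = N B].

(* pid_mx m : 'M[C]_(d, m) is the inclusion of the first m coordinates, so for
   m, n <= d this is B in the top left corner of a d x d zero matrix. *)
Definition pad d m n (B : 'M[C]_(m, n)) : 'M[C]_d :=
  (pid_mx m : 'M[C]_(d, m)) *m B *m (pid_mx n : 'M[C]_(n, d)).

Lemma padE d m n (B : 'M[C]_(m, n)) (i' : 'I_m) (j' : 'I_n) (i j : 'I_d) :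
  i = i' :> nat -> j = j' :> nat -> pad d B i j = B i' j'.
Proof.
move=> ii jj; rewrite !mxE (bigD1 j') //= !mxE (bigD1 i') //= !mxE.
rewrite ii jj !eqxx !ltn_ord /= mulr1 mul1r big1 ?addr0; last first.
  move=> l /negPf li; rewrite !mxE ii (inj_eq val_inj) eq_sym li.
  by rewrite mul0r.
rewrite big1 ?addr0 // => l /negPf lj.
by rewrite [X in _ * X]mxE jj (inj_eq val_inj) lj mulr0.
Qed.

Lemma pad_out d m n (B : 'M[C]_(m, n)) (i j : 'I_d) :
  (m <= i)%N || (n <= j)%N -> pad d B i j = 0.
Proof.
case/orP => [mi|nj]; rewrite /pad.
  rewrite -mulmxA mxE big1 // => l _; rewrite mxE.
  by rewrite gtn_eqF ?mul0r // (leq_trans (ltn_ord l)).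
rewrite mxE big1 // => l _; rewrite [X in _ * X]mxE.
by rewrite ltn_eqF ?mulr0 // (leq_trans (ltn_ord l)).
Qed.

Definition residual d k (A : 'M[C]_d) (Q : 'M[C]_(d, k)) : 'M[C]_(d, k) :=
  A *m Q - Q *m (Q ^t* *m A *m Q).

Definition diag_tan k (Th : 'I_k -> R) : 'M[C]_k :=
  diag_mx (\row_i (tan (Th i))%:C%C).

End Norms.

(* Main.v *)
(* Write H for the compression of A to X + Y. Part 1 holds with delta' = delta:
   S embeds the orthogonal complement of S^*X isometrically into that of X, so
   the spectrum there stays in [a, b] (Rayleigh quotients), and the Ritz values
   on Y do not change.

   For part 2, shift H so that a + b = 0 and put r = (b - a) / 2 and
   rho = r + delta'. Choose an orthonormal basis W of S^*Y for which the cosines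
   c_i are diagonal, let s_i be the sines, and let R be the residual of W. The
   equation V^* R = L Z - Z A_1, with V a basis of the complement of S^*X,
   Z = V^* W, L = V^* H V and A_1 = W^* H W, first rules out c_i = 0, and then
   becomes
     diag(s/c) = diag(1/c) M diag(s) K - J R K
   with M, K Hermitian, |M| <= r, K = A_1^-1, |K| <= 1/rho and J a partial
   isometry. A unitarily invariant norm of diag(s/c) is attained by a functional
   B |-> sum_i z_i Re B_ii with z >= 0 ordered like s/c (Hahn-Banach, pinching
   and permutation invariance). On the first term this functional is at most
   (r / rho) |diag(s/c)|: since M and K are Hermitian the weights
   |m_ij| |k_ji| are symmetric with row sums at most r / rho, and z/c and s are
   similarly ordered. This replaces Horn's inequality and Ky Fan dominance. *)

Require Import Defs.
From HB Require Import structures.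
From mathcomp Require Import all_boot all_order all_algebra.
From mathcomp Require Import sesquilinear spectral.
From mathcomp Require Import all_classical all_reals all_analysis.
From mathcomp Require Import complex.
From mathcomp Require Import fingroup perm zify ring lra.

Import Order.TTheory GRing.Theory Num.Theory.

Local Open Scope ring_scope.
Local Open Scope sesquilinear_scope.

Section TanTheta.
Set Implicit Arguments.
Unset Strict Implicit.
Unset Printing Implicit Defensive.
Context {R : realType}.
Local Notation C := R[i].
Local Notation normc := Normc.normc.

(** * Adjoints, operator bounds and singular values *)

Lemma adjmxM m n p (A : 'M[C]_(m, n)) (B : 'M[C]_(n, p)) :
  (A *m B) ^t* = B ^t* *m A ^t*.
Proof. by rewrite trmx_mul map_mxM. Qed.

Lemma adjmxD m n (A B : 'M[C]_(m, n)) : (A + B) ^t* = A ^t* + B ^t*.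
Proof. by rewrite linearD map_mxD. Qed.

Lemma adjmxB m n (A B : 'M[C]_(m, n)) : (A - B) ^t* = A ^t* - B ^t*.
Proof. by rewrite linearB map_mxB. Qed.

Lemma adjmx1 n : (1%:M : 'M[C]_n) ^t* = 1%:M.
Proof. by rewrite trmx1 map_mx1. Qed.

Lemma adjmx0 m n : (0 : 'M[C]_(m, n)) ^t* = 0.
Proof. by rewrite trmx0 map_mx0. Qed.

Lemma hermsymmxP n (A : 'M[C]_n) : reflect (A ^t* = A) (A \is hermsymmx).
Proof.
by apply: (iffP (is_hermitianmxP _ _ _)); rewrite expr0 scale1r => /esym.
Qed.

Lemma conjC_real (a : R) : (a%:C%C)^* = a%:C%C.
Proof. exact: conjc_real. Qed.

Lemma mulCJ (z : C) : z * z^* = (normc z ^+ 2)%:C%C.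
Proof. by rewrite rmorphXn -sqr_normc. Qed.

Lemma normc_ge0 (z : C) : 0 <= normc z.
Proof. by case: z => x y; exact: sqrtr_ge0. Qed.

Lemma normc_real (a : R) : normc a%:C%C = `|a|.
Proof. by rewrite /= expr0n /= addr0 sqrtr_sqr. Qed.

Definition rdiag n (s : 'I_n -> R) : 'M[C]_n := diag_mx (\row_i (s i)%:C%C).

Lemma rdiagM n (s t : 'I_n -> R) :
  rdiag s *m rdiag t = rdiag (fun i => s i * t i).
Proof.
rewrite mulmx_diag; congr diag_mx; apply/rowP => i.
by rewrite !mxE rmorphM.
Qed.

Lemma eq_rdiag n (s t : 'I_n -> R) : s =1 t -> rdiag s = rdiag t.
Proof. by move=> st; congr diag_mx; apply/rowP => i; rewrite !mxE st. Qed.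

Lemma rdiag1 n : rdiag (fun=> 1) = 1%:M :> 'M[C]_n.
Proof. by apply/matrixP => i j; rewrite !mxE. Qed.

Lemma adj_rdiag n (s : 'I_n -> R) : (rdiag s) ^t* = rdiag s.
Proof.
rewrite tr_diag_mx map_diag_mx; congr diag_mx; apply/rowP => i.
by rewrite !mxE; apply: conjC_real.
Qed.

Lemma rdiag_perm k (s : {perm 'I_k}) (t : 'I_k -> R) :
  rdiag (t \o s) = perm_mx s *m rdiag t *m perm_mx s^-1.
Proof.
apply/matrixP => i j; rewrite -row_permE -col_permE !mxE.
by rewrite (inj_eq perm_inj).
Qed.

Lemma adj_perm_mx k (s : {perm 'I_k}) :
  (perm_mx s : 'M[C]_k) ^t* = perm_mx s^-1.
Proof. by rewrite tr_perm_mx map_perm_mx. Qed.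

Lemma mul_rdiagE m n (s : 'I_m -> R) (B : 'M[C]_(m, n)) i j :
  (rdiag s *m B) i j = (s i)%:C%C * B i j.
Proof. by rewrite mul_diag_mx !mxE. Qed.

Lemma mulmx_rdiagE m n (B : 'M[C]_(m, n)) (s : 'I_n -> R) i j :
  (B *m rdiag s) i j = B i j * (s j)%:C%C.
Proof. by rewrite mul_mx_diag !mxE. Qed.

Definition sqn n (x : 'rV[C]_n) : R := \sum_j normc (x 0 j) ^+ 2.

Lemma sqnE n (x : 'rV[C]_n) : x *m x ^t* = ((sqn x)%:C%C)%:M.
Proof.
apply/matrixP => i j; rewrite !ord1 !mxE mulr1n rmorph_sum.
by apply: eq_bigr => l _; rewrite !mxE; apply: mulCJ.
Qed.

Lemma sqn_ge0 n (x : 'rV[C]_n) : 0 <= sqn x.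
Proof. by apply: sumr_ge0 => i _; apply: sqr_ge0. Qed.

Lemma sqn_eq0 n (x : 'rV[C]_n) : sqn x = 0 -> x = 0.
Proof.
move/eqP; rewrite psumr_eq0 => [/allP x0|i _]; last exact: sqr_ge0.
apply/rowP => i; rewrite mxE; apply: Normc.eq0_normc; apply/eqP.
by rewrite -sqrf_eq0; apply: (x0 i); rewrite mem_index_enum.
Qed.

Lemma sqn_row m n (A : 'M[C]_(m, n)) i :
  (sqn (row i A))%:C%C = (A *m A ^t*) i i.
Proof.
rewrite rmorph_sum mxE; apply: eq_bigr => j _.
by rewrite /= !mxE; apply/esym/mulCJ.
Qed.

Lemma mulmx_adj_eq0 m n (A : 'M[C]_(m, n)) : A *m A ^t* = 0 -> A = 0.
Proof.
move=> A0; apply/row_matrixP => i; rewrite row0; apply: sqn_eq0.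
by apply: complexI; rewrite sqn_row A0 mxE.
Qed.

Lemma gram_rdiag_id m n (A : 'M[C]_(m, n)) (s e : 'I_m -> R) :
  A *m A ^t* = rdiag s -> (forall i, s i != 0 -> e i = 1) -> rdiag e *m A = A.
Proof.
move=> AA es; apply/matrixP => i j; rewrite mul_rdiagE.
have [s0|/es ->] := eqVneq (s i) 0; last by rewrite mul1r.
suff /rowP/(_ j) : row i A = 0 by rewrite !mxE => ->; rewrite mulr0.
by apply: sqn_eq0; apply: complexI; rewrite sqn_row AA !mxE eqxx mulr1n s0.
Qed.

(** A bound on the operator norm for the action on row vectors, squared to avoid roots. It
    constrains only the absolute value of [c]. *)
Definition op_bound m n (c : R) (E : 'M[C]_(m, n)) :=
  forall x : 'rV[C]_m, sqn (x *m E) <= c ^+ 2 * sqn x.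

Lemma op_boundM m n p c e (E : 'M[C]_(m, n)) (F : 'M[C]_(n, p)) :
  op_bound c E -> op_bound e F -> op_bound (c * e) (E *m F).
Proof.
move=> hE hF x; rewrite mulmxA (le_trans (hF _)) //.
by rewrite exprMn (mulrC (c ^+ 2)) -(mulrA _ (c ^+ 2)) ler_wpM2l ?sqr_ge0.
Qed.

(** Pythagoras: [E *m E ^t*] is an orthogonal projection, the part of [x] in its range is as long as
    [x *m E], and the rest is orthogonal to that part. *)
Lemma op_bound_partial_isometry m n (E : 'M[C]_(m, n)) :
  E *m E ^t* *m E = E -> op_bound 1 E.
Proof.
move=> EEE x; rewrite expr1n mul1r.
suff -> : sqn x = sqn (x *m E) + sqn (x - x *m E *m E ^t*).
  by rewrite lerDl sqn_ge0.
apply: complexI.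
have cE k (y : 'rV[C]_k) : (sqn y)%:C%C = (y *m y ^t*) 0 0.
  by rewrite sqnE mxE mulr1n.
rewrite raddfD /= !cE.
suff -> : x *m x ^t* = x *m E *m (x *m E) ^t* +
    (x - x *m E *m E ^t*) *m (x - x *m E *m E ^t*) ^t* by rewrite mxE.
rewrite !adjmxM adjmxB !adjmxM trmxCK mulmxBl !mulmxBr.
rewrite !mulmxA.
have -> : x *m E *m E ^t* *m E = x *m E.
  by rewrite -!mulmxA (mulmxA E) EEE.
by rewrite subrr subr0 addrC subrK.
Qed.

Lemma op_bound_isometry m n (E : 'M[C]_(m, n)) :
  E ^t* *m E = 1%:M -> op_bound 1 E.
Proof.
by move=> EE; apply: op_bound_partial_isometry; rewrite -mulmxA EE mulmx1.
Qed.

Lemma op_bound_coisometry m n (E : 'M[C]_(m, n)) :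
  E *m E ^t* = 1%:M -> op_bound 1 E.
Proof.
by move=> EE; apply: op_bound_partial_isometry; rewrite EE mul1mx.
Qed.

Lemma op_bound_pid m n k : op_bound 1 (pid_mx k : 'M[C]_(m, n)).
Proof.
apply: op_bound_partial_isometry.
rewrite tr_pid_mx map_pid_mx !mul_pid_mx.
by rewrite minnn -[RHS]pid_mx_minv -[RHS]pid_mx_minh; congr pid_mx; lia.
Qed.

Lemma op_bound_rdiag n c (s : 'I_n -> R) :
  (forall i, `|s i| <= c) -> op_bound c (rdiag s).
Proof.
move=> sc x; rewrite /sqn mulr_sumr; apply: ler_sum => j _.
rewrite mulmx_rdiagE Normc.normcM exprMn mulrC ler_wpM2r ?sqr_ge0 //.
by rewrite /= expr0n /= addr0 sqrtr_sqr ler_sqr ?nnegrE // (le_trans _ (sc j)).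
Qed.

Lemma op_bound_pad d m n c (E : 'M[C]_(m, n)) :
  op_bound c E -> op_bound c (pad d E).
Proof.
move=> hE; rewrite -[c]mul1r -[X in op_bound X]mulr1.
by apply: op_boundM; last exact: op_bound_pid;
   apply: op_boundM; first exact: op_bound_pid.
Qed.

Lemma op_bound_row m n c (E : 'M[C]_(m, n)) i :
  op_bound c E -> sqn (row i E) <= c ^+ 2.
Proof.
move=> /(_ (delta_mx 0 i)); rewrite -rowE.
suff -> : sqn (delta_mx 0 i : 'rV[C]_m) = 1 by rewrite mulr1.
rewrite /sqn (bigD1 i) //= mxE !eqxx big1 => [|j ji].
  by rewrite Normc.normc1 expr1n addr0.
by rewrite mxE (negbTE ji) andbF Normc.normc0 expr0n.
Qed.

(** Induction on the number of zero rows of [J]: each is filled with a unit vector orthogonal to the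
    other rows, until [J] is unitary. Masking with [e] erases the added rows again. *)
Lemma complete_rows n (J : 'M[C]_n) (e : 'I_n -> bool) :
  J *m J ^t* = rdiag (fun i => (e i)%:R) ->
  exists2 U, U \is unitarymx & J = rdiag (fun i => (e i)%:R) *m U.
Proof.
have [m] := ubnP #|[pred i | ~~ e i]|.
elim: m => // m IHm in J e *; rewrite ltnS => em JJ.
have eJ : rdiag (fun i => (e i)%:R) *m J = J.
  by apply: (gram_rdiag_id JJ) => i; case: (e i); rewrite ?eqxx.
have [e1|[i /negbTE ei]] : (forall i, e i) \/ exists i, ~~ e i.
  case: (boolP [forall i, e i]) => [/forallP|]; first by left.
  by rewrite negb_forall => /existsP; right.
  exists J; last by rewrite eJ.
  apply/unitarymxP; rewrite JJ -rdiag1; apply: eq_rdiag => i.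
  by rewrite e1.
(* Row [i] of [J] is zero, so [J] is singular and a nonzero vector is orthogonal to all its rows; it
   is then normalised. *)
have [v vn0 vJ] : exists2 v : 'rV[C]_n, sqn v = 1 & v *m J ^t* = 0.
  have : ~~ row_free (J ^t*).
    apply/negP; rewrite row_free_unit => Ju.
    have : delta_mx 0 i *m J = 0 :> 'rV[C]_n.
      by rewrite -rowE -eJ; apply/rowP => j; rewrite mxE mul_rdiagE ei mul0r mxE.
    have JU : J \in unitmx by rewrite -(trmxCK J) map_unitmx unitmx_tr.
    move=> /(congr1 (mulmx^~ (invmx J))); rewrite mulmxK // mul0mx.
    by move/matrixP/(_ 0 i); rewrite !mxE !eqxx => /eqP; rewrite oner_eq0.
  rewrite -kermx_eq0 => /rowV0Pn[v /sub_kermxP vJ v0].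
  have vp : 0 < sqn v.
    by rewrite lt_def sqn_ge0 andbT; apply: contra_neq v0; exact: sqn_eq0.
  exists (((Num.sqrt (sqn v))^-1)%:C%C *: v); last by rewrite -scalemxAl vJ scaler0.
  rewrite /sqn; under eq_bigr do rewrite mxE Normc.normcM exprMn.
  rewrite -mulr_sumr -/(sqn v) /= expr0n /= addr0 sqrtr_sqr.
  rewrite ger0_norm ?invr_ge0 ?sqrtr_ge0 // exprVn sqr_sqrtr ?sqn_ge0 //.
  by rewrite mulVf // gt_eqF.
have Jv : J *m v ^t* = 0.
  by apply: (can_inj (@trmxCK _ _ _)); rewrite adjmxM trmxCK vJ adjmx0.
pose e' j := (j == i) || e j.
have [||U Uu UE] := IHm (J + delta_mx i 0 *m v) e'.
- rewrite (leq_trans _ em) //; apply: proper_card; apply/fintype.properP; split.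
    by apply/fintype.subsetP => j; rewrite !inE negb_or => /andP[].
  by exists i; rewrite !inE /e' ?ei ?eqxx.
- rewrite adjmxD adjmxM mulmxDl !mulmxDr JJ mulmxA Jv mul0mx addr0.
  rewrite -!mulmxA (mulmxA v) vJ mulmx0 add0r sqnE vn0 mul1mx.
  rewrite trmx_delta map_delta_mx mul_delta_mx.
  apply/matrixP => a b; rewrite !mxE /e'.
  case: (eqVneq a b) => [->|ab]; last first.
    by rewrite !mulr0n add0r; case: (eqVneq a i) => // <-; rewrite eq_sym (negbTE ab).
  by rewrite !mulr1n andbb; case: (eqVneq b i) => [->|]; rewrite ?ei ?add0r ?addr0.
exists U => //.
have -> : J = rdiag (fun i => (e i)%:R) *m (J + delta_mx i 0 *m v).
  rewrite mulmxDr eJ; apply/matrixP => a b.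
  rewrite [RHS]mxE mul_rdiagE mxE big_ord1 !mxE.
  by case: (eqVneq a i) => [->|]; rewrite ?ei /= ?mul0r ?mulr0 addr0.
rewrite UE mulmxA rdiagM; congr (_ *m U); apply: eq_rdiag => j.
by rewrite /e'; case: (e j); rewrite ?orbT ?mulr1 ?mul0r.
Qed.

Lemma hermitian_diag n (A : 'M[C]_n) : A ^t* = A ->
  exists U : 'M[C]_n, exists2 s : 'I_n -> R, U \is unitarymx &
    A = U ^t* *m rdiag s *m U.
Proof.
move=> /hermsymmxP AH; exists (spectralmx A), (fun i => complex.Re (spectral_diag A 0 i)).
  exact: spectral_unitarymx.
have /orthomx_spectralP {1}-> := hermitian_normalmx AH.
congr (_ *m diag_mx _ *m _); first exact/invmx_unitary/spectral_unitarymx.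
apply/rowP => i; rewrite mxE RRe_real //.
by have /mxOverP := hermitian_spectral_diag_real AH; apply.
Qed.

(** When [U] diagonalises [B *m B ^t*], the rows of [U *m B] are orthogonal. Their lengths are the
    singular values, and the normalised nonzero rows complete to a unitary [V]. *)
Lemma svd n (B : 'M[C]_n) : exists U V : 'M[C]_n, exists2 s : 'I_n -> R,
  [/\ U \is unitarymx, V \is unitarymx & forall i, 0 <= s i] &
  B = U *m rdiag s *m V.
Proof.
have [|U [s Uu BE]] := @hermitian_diag n (B *m B ^t*).
  by rewrite adjmxM trmxCK.
have UU := unitarymxP Uu; have UU' := mulmx1C UU.
have UBB : (U *m B) *m (U *m B) ^t* = rdiag s.
  by rewrite adjmxM -mulmxA (mulmxA B) BE !mulmxA UU mul1mx -mulmxA UU mulmx1.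
have s0 i : 0 <= s i.
  rewrite (_ : s i = sqn (row i (U *m B))) ?sqn_ge0 //; apply: complexI.
  by rewrite sqn_row UBB !mxE eqxx mulr1n.
pose t i := Num.sqrt (s i).
have tt i : t i * t i = s i by rewrite -expr2 sqr_sqrtr.
(* The inverse of 0 is 0, so rows of length 0 stay zero, in accordance with the mask [t i != 0]. *)
have [|V Vu VE] := @complete_rows n (rdiag (fun i => (t i)^-1) *m (U *m B))
                     (fun i => t i != 0).
  rewrite adjmxM adj_rdiag -mulmxA (mulmxA (U *m B)) UBB !rdiagM.
  apply: eq_rdiag => i; rewrite -tt; have [->|ti] := eqVneq (t i) 0.
    by rewrite invr0 !mul0r.
  by rewrite mulfK // mulVf.
exists (U ^t*), V, t.
  split; [by apply/unitarymxP; rewrite trmxCK | exact: Vu | move=> i; exact: sqrtr_ge0].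
suff UBE : U *m B = rdiag t *m V by rewrite -mulmxA -UBE mulmxA UU' mul1mx.
have -> : U *m B = rdiag t *m (rdiag (fun i => (t i)^-1) *m (U *m B)).
  rewrite mulmxA rdiagM (gram_rdiag_id UBB) // => i si.
  by rewrite divff //; apply: contra si => /eqP ti; rewrite -tt ti mul0r.
rewrite VE mulmxA rdiagM; congr (_ *m V); apply: eq_rdiag => i.
by have [->|ti] := eqVneq (t i) 0; rewrite ?mul0r ?mulr1.
Qed.

(** * Unitarily invariant norms *)

Section SquareNorm.
Variables (d : nat) (N : 'M[C]_d -> R).
Hypothesis hN : unitarily_invariant_norm N.

Lemma normZ_real (a : R) B : N (a%:C%C *: B) = `|a| * N B.
Proof. by case: hN => _ _ -> _ _; rewrite normc_real. Qed.

Lemma norm_triangle B B' : N (B + B') <= N B + N B'. Proof. by case: hN. Qed.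

Lemma normUl U B : U \is unitarymx -> N (U *m B) = N B.
Proof.
case: hN => _ _ _ _ h Uu; rewrite -{1}[B]mulmx1 mulmxA; apply: h Uu _.
by apply/unitarymxP; rewrite mul1mx adjmx1.
Qed.

Lemma normUr U B : U \is unitarymx -> N (B *m U) = N B.
Proof.
case: hN => _ _ _ _ h Uu; rewrite -{1}[B]mul1mx; apply: h Uu.
by apply/unitarymxP; rewrite mul1mx adjmx1.
Qed.

Lemma norm_zero : N 0 = 0.
Proof. by rewrite -(scale0r (0 : 'M[C]_d)) (normZ_real 0) normr0 mul0r. Qed.

(* A real number [x] with [|x| <= 1] is the mean of the two unimodular numbers
   [x +- i sqrt (1 - x^2)]. *)
Lemma norm_rdiag_le c (s : 'I_d -> R) B :
  (forall i, `|s i| <= c) -> N (rdiag s *m B) <= c * N B.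
Proof.
move=> sc; have [c0|c0] := leP c 0.
  have -> : rdiag s = 0.
    apply/matrixP => i j; rewrite !mxE.
    have /eqP -> : s i == 0 by rewrite -normr_le0 (le_trans (sc i)).
    by rewrite mul0rn.
  have [i|d0] : 'I_d + (d = 0%N).
    by clear; case: d => [|n]; [right | left; exact: ord0].
    have /eqP -> : c == 0 by rewrite eq_le c0 (le_trans _ (sc i)).
    by rewrite mul0mx norm_zero mul0r.
  have -> : B = 0 by apply/matrixP => i; have := ltn_ord i; rewrite [X in (_ < X)%N]d0.
  by rewrite mulmx0 norm_zero mulr0.
pose x i := s i / c.
have x1 i : x i ^+ 2 <= 1.
  rewrite -(ger0_norm (sqr_ge0 _)) normrX expr_le1 //.
  by rewrite normrM normfV (gtr0_norm c0) ler_pdivrMr // mul1r.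
pose u (e : R) : 'M[C]_d :=
  diag_mx (\row_i (Complex (x i) (e * Num.sqrt (1 - x i ^+ 2)))).
have uu e : e ^+ 2 = 1 -> u e \is unitarymx.
  move=> e1; apply/unitarymxP.
  rewrite tr_diag_mx map_diag_mx mulmx_diag -diag_const_mx; congr diag_mx.
  apply/rowP => i; rewrite !mxE mulCJ /= sqr_sqrtr ?addr_ge0 ?sqr_ge0 //.
  by rewrite [(e * _) ^+ 2]exprMn e1 mul1r sqr_sqrtr ?subr_ge0 // addrC subrK.
have -> : rdiag s = (c / 2)%:C%C *: (u 1 + u (- 1)).
  apply/matrixP => i j; rewrite !mxE.
  have [->|_] := eqVneq i j; last by rewrite !mulr0n addr0 mulr0.
  rewrite !mulr1n; apply/eqP; rewrite eq_complex /= /x.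
  by apply/andP; split; apply/eqP; field; rewrite gt_eqF.
rewrite -scalemxAl normZ_real gtr0_norm ?divr_gt0 // mulmxDl.
have := norm_triangle (u 1 *m B) (u (- 1) *m B).
have uN1 : u (-1) \is unitarymx by apply: uu; rewrite sqrrN expr1n.
rewrite (normUl _ (uu 1 (expr1n _ _))) (normUl _ uN1) => h.
rewrite (_ : c * N B = (c / 2) * (N B + N B)); last by field.
by rewrite ler_wpM2l ?divr_ge0 // ltW.
Qed.

End SquareNorm.

(** The [i]-th singular value is the length of row [i] of [U ^t* *m E], and [c] bounds this product
    as it bounds [E]. *)
Lemma op_bound_svd d c (E : 'M[C]_d) : 0 <= c -> op_bound c E ->
  exists U V : 'M[C]_d, exists2 s : 'I_d -> R,
    [/\ U \is unitarymx, V \is unitarymx & forall i, `|s i| <= c] &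
    E = U *m rdiag s *m V.
Proof.
move=> c0 hE; have [U [V [s [Uu Vu s0] EE]]] := svd E.
exists U, V, s => //; split=> // i.
have UU := mulmx1C (unitarymxP Uu).
have hUE : op_bound c (U ^t* *m E).
  by rewrite -[c]mul1r; apply: op_boundM hE; apply/op_bound_coisometry; rewrite trmxCK.
have UE : U ^t* *m E = rdiag s *m V by rewrite EE !mulmxA UU mul1mx.
have := op_bound_row i hUE; rewrite UE.
suff -> : sqn (row i (rdiag s *m V)) = s i ^+ 2.
  by rewrite ler_sqr ?nnegrE ?s0 // ger0_norm.
apply: complexI; rewrite sqn_row adjmxM adj_rdiag -mulmxA (mulmxA V).
by rewrite (unitarymxP Vu) mul1mx rdiagM !mxE eqxx mulr1n.
Qed.

Lemma norm_boundl d (N : 'M[C]_d -> R) c (E B : 'M[C]_d) :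
  unitarily_invariant_norm N -> 0 <= c -> op_bound c E ->
  N (E *m B) <= c * N B.
Proof.
move=> hN c0 /(op_bound_svd c0)[U [V [s [Uu Vu sc] ->]]].
rewrite -!mulmxA (normUl hN _ Uu) (le_trans (norm_rdiag_le hN _ sc)) //.
by rewrite (normUl hN _ Vu).
Qed.

(** Exchanges left and right factors, so that bounds for a left factor give bounds for a right
    one. *)
Lemma trmx_invariant_norm d (N : 'M[C]_d -> R) :
  unitarily_invariant_norm N -> unitarily_invariant_norm (fun B => N B^T).
Proof.
case=> h1 h2 h3 h4 h5; split=> //.
- by move=> B /h2 /(congr1 trmx); rewrite trmxK trmx0.
- by move=> c B; rewrite linearZ h3.
- by move=> B B'; rewrite linearD h4.
- by move=> U B V Uu Vu; rewrite !trmx_mul mulmxA h5 ?trmx_unitary.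
Qed.

Lemma norm_boundr d (N : 'M[C]_d -> R) c (E B : 'M[C]_d) :
  unitarily_invariant_norm N -> 0 <= c -> op_bound c E ->
  N (B *m E) <= c * N B.
Proof.
move=> hN c0 /(op_bound_svd c0)[U [V [s [Uu Vu sc] ->]]].
have hT := trmx_invariant_norm hN.
rewrite mulmxA (normUr hN _ Vu) mulmxA.
have := norm_rdiag_le hT (B *m U)^T sc.
by rewrite !trmx_mul !trmxK tr_diag_mx (normUr hN _ Uu).
Qed.

Lemma padM d m n p (A : 'M[C]_(m, n)) (B : 'M[C]_(n, p)) : (n <= d)%N ->
  pad d (A *m B) = pad d A *m pad d B.
Proof.
move=> nd; rewrite /pad !mulmxA -(mulmxA (pid_mx m *m A) (pid_mx n)) pid_mx_id //.
by rewrite pid_mx_1 mulmx1.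
Qed.

Lemma norm_pad_boundl d (N : 'M[C]_d -> R) m n p c (E : 'M[C]_(m, n))
    (B : 'M[C]_(n, p)) :
  unitarily_invariant_norm N -> 0 <= c -> (n <= d)%N -> op_bound c E ->
  N (pad d (E *m B)) <= c * N (pad d B).
Proof.
by move=> hN c0 nd hE; rewrite padM //; apply: norm_boundl => //;
  apply: op_bound_pad.
Qed.

Lemma norm_pad_boundr d (N : 'M[C]_d -> R) m n p c (B : 'M[C]_(m, n))
    (E : 'M[C]_(n, p)) :
  unitarily_invariant_norm N -> 0 <= c -> (n <= d)%N -> op_bound c E ->
  N (pad d (B *m E)) <= c * N (pad d B).
Proof.
by move=> hN c0 nd hE; rewrite padM //; apply: norm_boundr => //;
  apply: op_bound_pad.
Qed.

(** A padded unitary is only a partial isometry, so invariance is proved as two inequalities: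
    unitary factors do not increase the norm, and neither do their adjoints, which undo them. *)
Lemma pad_invariant_norm d k (N : 'M[C]_d -> R) : (k <= d)%N ->
  unitarily_invariant_norm N ->
  unitarily_invariant_norm (fun B : 'M[C]_k => N (pad d B)).
Proof.
move=> kd hN; have [h1 h2 h3 h4 _] := hN; split=> //.
- move=> B /h2 B0.
  have : (pid_mx k : 'M[C]_(k, d)) *m pad d B *m (pid_mx k : 'M[C]_(d, k)) = B.
    by rewrite /pad !mulmxA pid_mx_id // -!mulmxA pid_mx_id // pid_mx_1 mulmx1 mul1mx.
  by rewrite B0 mulmx0 mul0mx.
- by move=> c B; rewrite /pad -scalemxAr -scalemxAl h3.
- by move=> B B'; rewrite /pad mulmxDr mulmxDl h4.
move=> U B V Uu Vu.
have bd (W : 'M[C]_k) : W \is unitarymx -> op_bound 1 W.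
  by move=> /unitarymxP; exact: op_bound_coisometry.
have le (A U' V' : 'M[C]_k) : U' \is unitarymx -> V' \is unitarymx ->
    N (pad d (U' *m A *m V')) <= N (pad d A).
  move=> U'u V'u; have := norm_pad_boundr (U' *m A) hN ler01 kd (bd _ V'u).
  by have := norm_pad_boundl A hN ler01 kd (bd _ U'u); rewrite !mul1r => h /le_trans ->.
apply: le_anti; apply/andP; split; first exact: (le _ _ _ Uu Vu).
have {1}-> : B = U ^t* *m (U *m B *m V) *m V ^t*.
  rewrite !mulmxA (mulmx1C (unitarymxP Uu)) mul1mx -mulmxA (unitarymxP Vu).
  by rewrite mulmx1.
by apply: le; apply/unitarymxP; rewrite trmxCK; apply/mulmx1C/unitarymxP.
Qed.

Section Pinching.
Variables (k : nat) (N : 'M[C]_k -> R).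
Hypothesis hN : unitarily_invariant_norm N.

(* Averaging with the conjugate by a sign flip of the [i]-th coordinate kills
   the off-diagonal entries of row and column [i]. *)
Lemma norm_pinch_seq (s : seq 'I_k) (B : 'M[C]_k) :
  N (\matrix_(a, b) if has (fun i => (a == i) != (b == i)) s then 0 else B a b)
  <= N B.
Proof.
elim: s => [|i s IHs].
  by rewrite (_ : \matrix_(a, b) _ = B) //; apply/matrixP => a b; rewrite mxE.
set M := \matrix_(_, _) _ in IHs.
pose f : 'M[C]_k := rdiag (fun j => if j == i then -1 else 1).
have fu : f \is unitarymx.
  apply/unitarymxP; rewrite adj_rdiag rdiagM -rdiag1; apply: eq_rdiag => j.
  by case: ifP; rewrite ?mulrNN mulr1.
have -> : \matrix_(a, b) (if has (fun i => (a == i) != (b == i)) (i :: s)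
     then 0 else B a b) = (2^-1)%:C%C *: (M + f *m M *m f).
  apply/matrixP => a b.
  rewrite [RHS]mxE [X in _ = _ * X]mxE mulmx_rdiagE mul_rdiagE !mxE /=.
  have half (z : C) : (2^-1)%:C%C * (z + z) = z.
    by case: z => x y; apply/eqP; rewrite eq_complex /=; apply/andP; split;
      apply/eqP; field.
  case: (has _ s); first by rewrite orbT mulr0 mul0r addr0 mulr0.
  rewrite orbF; case: (a == i); case: (b == i) => /=;
    rewrite ?rmorphN ?rmorph1 ?mulN1r ?mulrN1 ?mulr1 ?mul1r ?opprK ?subrr ?mulr0 //;
    by rewrite half.
apply: le_trans IHs; rewrite normZ_real // ger0_norm ?invr_ge0 //.
rewrite mulrC ler_pdivrMr // mulr_natr mulr2n.
by apply: le_trans (norm_triangle hN _ _) _; rewrite (normUr hN _ fu) (normUl hN _ fu).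
Qed.

(** A diagonal unitary factor first turns each diagonal entry into its modulus, with phase 1 where
    the entry is 0; pinching at every coordinate then removes all other entries. *)
Lemma norm_pinch (B : 'M[C]_k) :
  N (rdiag (fun i => normc (B i i))) <= N B.
Proof.
pose u : 'M[C]_k := diag_mx (\row_i
  if B i i == 0 then 1 else (normc (B i i))%:C%C / B i i).
have uu : u \is unitarymx.
  apply/unitarymxP.
  rewrite tr_diag_mx map_diag_mx mulmx_diag -diag_const_mx; congr diag_mx.
  apply/rowP => i; rewrite !mxE mulCJ; have [_|b0] := eqVneq (B i i) 0.
    by rewrite Normc.normc1 expr1n.
  rewrite Normc.normcM Normc.normcV /= expr0n /= addr0 sqrtr_sqr.
  have n0 : normc (B i i) != 0.
    by apply: contra b0 => /eqP /Normc.eq0_normc ->.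
  rewrite ger0_norm ?divff ?expr1n //.
  exact: normc_ge0.
rewrite -[leRHS](normUl hN _ uu).
apply: le_trans (norm_pinch_seq (enum 'I_k) (u *m B)).
rewrite le_eqVlt; apply/orP; left; apply/eqP; congr N; apply/matrixP => a b.
rewrite [RHS]mxE; have [->|ab] := eqVneq a b.
  rewrite ifF; last by apply/hasP => -[i _]; rewrite eqxx.
  rewrite mul_diag_mx !mxE eqxx mulr1n; case: eqP => [->|/eqP b0].
    by rewrite mulr0 Normc.normc0.
  by rewrite divfK.
rewrite ifT ?mxE ?(negbTE ab) //; apply/hasP; exists a; rewrite ?mem_enum //.
by rewrite eqxx (eq_sym b) (negbTE ab).
Qed.

End Pinching.

(** * Linear functionals below a sublinear one *)

Definition sublinear (V : lmodType R) (p : V -> R) :=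
  (forall x y, p (x + y) <= p x + p y) /\
  (forall a x, 0 <= a -> p (a *: x) = a * p x).

Section OneDirection.
Variables (V : lmodType R) (p : V -> R).
Hypothesis hp : sublinear p.

Lemma sublinear0 : p 0 = 0.
Proof. by rewrite -(scale0r 0) hp.2 // mul0r. Qed.

Lemma sublinearN x : 0 <= p x + p (- x).
Proof. by rewrite -sublinear0 -(subrr x) hp.1. Qed.

(* The largest sublinear minorant [q] of [p] with [q (- v) = - p v], that is,
   linear on the line of [v] and equal to [p] at [v]. *)
Definition ray_minorant (v x : V) : R :=
  inf [set p (x + s *: v) - s * p v | s in [set s : R | 0 <= s]]%classic.

Lemma ray_minorant_has_inf v x :
  has_inf [set p (x + s *: v) - s * p v | s in [set s : R | 0 <= s]]%classic.
Proof.
split; first by exists (p (x + 0 *: v) - 0 * p v), 0 => /=.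
exists (- p (- x)) => _ [s /= s0 <-].
rewrite -(hp.2 _ _ s0).
by have := hp.1 (x + s *: v) (- x); rewrite addrAC subrr add0r; lra.
Qed.

Lemma ray_minorant_le v x s : 0 <= s -> ray_minorant v x <= p (x + s *: v) - s * p v.
Proof. by move=> s0; apply: ge_inf; [exact: (ray_minorant_has_inf v x).2 | exists s]. Qed.

Lemma ray_minorant_ge v x b :
  (forall s, 0 <= s -> b <= p (x + s *: v) - s * p v) -> b <= ray_minorant v x.
Proof.
move=> h; apply: lb_le_inf; first exact: (ray_minorant_has_inf v x).1.
by move=> _ [s /= s0 <-]; apply: h.
Qed.

Lemma ray_minorant_le_base v x : ray_minorant v x <= p x.
Proof. by have := ray_minorant_le v x (lexx 0); rewrite scale0r mul0r addr0 subr0. Qed.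

Lemma ray_minorantN v : ray_minorant v (- v) <= - p v.
Proof.
by have := ray_minorant_le v (- v) ler01; rewrite scale1r mul1r addNr sublinear0 sub0r.
Qed.

(** Subadditivity comes from adding the shifts [s] and [t]. For homogeneity, scaling the shift gives
    one inequality, and the same with the inverse factor gives the other. *)
Lemma ray_minorant_sublinear v : sublinear (ray_minorant v).
Proof.
split=> [x y|a x a0].
  rewrite -lerBlDr; apply: ray_minorant_ge => s s0.
  suff : ray_minorant v (x + y) - (p (x + s *: v) - s * p v) <= ray_minorant v y by lra.
  apply: ray_minorant_ge => t t0; have := ray_minorant_le v (x + y) (addr_ge0 s0 t0).
  rewrite scalerDl addrACA mulrDl.
  have := hp.1 (x + s *: v) (y + t *: v); lra.
have le b y : 0 < b -> ray_minorant v (b *: y) <= b * ray_minorant v y.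
  move=> b0; rewrite -ler_pdivrMl //; apply: ray_minorant_ge => s s0.
  rewrite ler_pdivrMl //.
  apply: le_trans (ray_minorant_le v (b *: y) (mulr_ge0 (ltW b0) s0)) _.
  by rewrite -scalerA -scalerDr hp.2 ?(ltW b0) // mulrBr mulrA.
move: a0; rewrite le_eqVlt => /predU1P[<-|a0].
  rewrite mul0r scale0r; apply: le_anti; apply/andP; split.
    by rewrite -sublinear0 ray_minorant_le_base.
  by apply: ray_minorant_ge => s s0; rewrite add0r hp.2 // subrr.
apply: le_anti; rewrite le //=.
have := le a^-1 (a *: x); rewrite invr_gt0 scalerA mulVf ?gt_eqF // scale1r.
by move=> /(_ a0); rewrite ler_pdivlMl.
Qed.

End OneDirection.

(** Ray minorants are taken successively along [s]. Linearity along an earlier [v] survives: a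
    sublinear [q] below the ray minorant of [v] satisfies [q (- v) <= - p v <= - q v], and
    sublinearity gives the converse. *)
Lemma minorant_linear_on (V : lmodType R) (s : seq V) (p : V -> R) : sublinear p ->
  exists q, [/\ sublinear q, forall x, q x <= p x &
    forall v, v \in s -> q (- v) = - q v].
Proof.
elim: s p => [|v s IHs] p hp; first by exists p.
have [q [hq qp qs]] := IHs _ (ray_minorant_sublinear hp v).
exists q; split=> // [x|w].
  exact: le_trans (qp x) (ray_minorant_le_base hp v x).
rewrite inE => /predU1P[->|/qs //].
have := ray_minorantN hp v; have := sublinearN hq v; have := qp (- v).
have := qp v; have := ray_minorant_le_base hp v v; lra.
Qed.

(** Hahn-Banach in finite dimension: the ray minorant of [t] makes the functional touch [p] at [t],
    and linearity along the coordinate axes makes it linear. *)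
Lemma sublinear_row_support k (p : 'rV[R]_k -> R) (t : 'rV[R]_k) : sublinear p ->
  exists z : 'I_k -> R, (forall x : 'rV[R]_k, \sum_i z i * x 0 i <= p x) /\
    \sum_i z i * t 0 i = p t.
Proof.
move=> hp.
have [q [hq qp qs]] := minorant_linear_on (t :: [seq delta_mx 0 i | i : 'I_k])
  (ray_minorant_sublinear hp t).
have qN i : q (- delta_mx 0 i) = - q (delta_mx 0 i).
  by apply: qs; rewrite inE; apply/orP; right; apply/mapP; exists i; rewrite ?mem_enum.
have qZ a i : q (a *: delta_mx 0 i) = q (delta_mx 0 i) * a.
  have [a0|a0] := leP 0 a; first by rewrite hq.2 // mulrC.
  by rewrite -[a]opprK scaleNr -scalerN hq.2 ?oppr_ge0 ?ltW // qN; ring.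
(* Subadditivity over the coordinates puts [q] below the linear form; the same at [- x] gives the
   converse. *)
have qE x : q x <= \sum_i q (delta_mx 0 i) * x 0 i.
  rewrite {1}(row_sum_delta x).
  elim/big_ind2 : _ => [|u1 u2 v1 v2 h1 h2|i _]; first by rewrite sublinear0.
    by apply: le_trans (hq.1 _ _) _; apply: lerD.
  by rewrite qZ.
exists (fun i => q (delta_mx 0 i)).
have qE' (x : 'rV[R]_k) : \sum_i q (delta_mx 0 i) * x 0 i <= q x.
  have := qE (- x); under eq_bigr do rewrite mxE mulrN.
  rewrite sumrN; have := sublinearN hq x; lra.
split=> [x|].
  exact: le_trans (qE' x) (le_trans (qp x) (ray_minorant_le_base hp t x)).
have -> : \sum_i q (delta_mx 0 i) * t 0 i = q t by apply: le_anti; rewrite qE qE'.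
have := ray_minorantN hp t; have := sublinearN hq t; have := qp (- t).
have := qp t; have := ray_minorant_le_base hp t t; lra.
Qed.

(** * The dual pairing *)

Lemma normc_sum (I : finType) (F : I -> C) :
  normc (\sum_i F i) <= \sum_i normc (F i).
Proof.
elim/big_ind2 : _ => [|u1 u2 v1 v2 h1 h2|i _]; rewrite ?Normc.normc0 //.
by apply: le_trans (le_normcD _ _) _; apply: lerD.
Qed.

Lemma norm_rdiag_perm k (N : 'M[C]_k -> R) (s : {perm 'I_k}) (t : 'I_k -> R) :
  unitarily_invariant_norm N -> N (rdiag (t \o s)) = N (rdiag t).
Proof.
move=> hN.
have su (u : {perm 'I_k}) : (perm_mx u : 'M[C]_k) \is unitarymx.
  by apply/unitarymxP; rewrite adj_perm_mx -perm_mxM mulgV perm_mx1.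
rewrite rdiag_perm.
by rewrite (normUr hN _ (su _)) (normUl hN _ (su _)).
Qed.

(** Hahn-Banach on real diagonals supplies weights attaining the norm at [rdiag t]; sign flips make
    them nonnegative, pinching extends the bound to all matrices, and swapping entries orders them
    like [t]. *)
Lemma norm_support k (N : 'M[C]_k -> R) (t : 'I_k -> R) :
  unitarily_invariant_norm N -> (forall i, 0 <= t i) ->
  exists z : 'I_k -> R, [/\ forall i, 0 <= z i,
    forall B : 'M[C]_k, \sum_i z i * normc (B i i) <= N B,
    \sum_i z i * t i = N (rdiag t) &
    forall i j, 0 <= (z i - z j) * (t i - t j)].
Proof.
move=> hN t0.
have hp : sublinear (fun x : 'rV[R]_k => N (rdiag (fun i => x 0 i))).
  split=> [x y|a x a0].
    apply: le_trans (norm_triangle hN _ _); rewrite -raddfD /=.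
    rewrite le_eqVlt; apply/orP; left; apply/eqP; congr N; congr diag_mx.
    by apply/rowP => i; rewrite !mxE rmorphD.
  rewrite -[a in RHS]ger0_norm // -(normZ_real hN); congr N.
  by apply/matrixP => i j; rewrite !mxE rmorphM -mulrnAr.
have [z0 [z0p z0t]] := sublinear_row_support (\row_i t i) hp.
pose z i := `|z0 i|.
have zp (x : 'I_k -> R) : \sum_i z i * x i <= N (rdiag x).
  pose e i : R := if z0 i < 0 then -1 else 1.
  have := z0p (\row_i (e i * x i)).
  have -> : \sum_i z0 i * (\row_i (e i * x i)) 0 i = \sum_i z i * x i.
    apply: eq_bigr => i _; rewrite mxE /z /e; case: ltP => h.
      by rewrite ltr0_norm //; ring.
    by rewrite ger0_norm // mul1r.
  move=> /le_trans; apply.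
  have -> : rdiag (fun i => (\row_i (e i * x i)) 0 i) = rdiag e *m rdiag x.
    by rewrite rdiagM; apply: eq_rdiag => i; rewrite mxE.
  rewrite -[leRHS]mul1r; apply: norm_rdiag_le => // i.
  by rewrite /e; case: ifP; rewrite ?normrN normr1.
have zt : \sum_i z i * t i = N (rdiag t).
  apply: le_anti; rewrite zp /=.
  have -> : rdiag t = rdiag (fun i => (\row_i t i) 0 i).
    by apply: eq_rdiag => i; rewrite mxE.
  rewrite -z0t; apply: ler_sum => i _.
  by rewrite mxE ler_wpM2r // ler_norm.
exists z; split=> // [i|B|i j].
- exact: normr_ge0.
- exact: le_trans (zp _) (norm_pinch hN B).
have [->|ij] := eqVneq i j; first by rewrite subrr mul0r.
(* Swapping entries [i] and [j] of [t] preserves the norm, which the pairing with [z] already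
   attains at [t], so the pairing cannot increase. *)
have := zp (t \o tperm i j); rewrite norm_rdiag_perm // -zt.
rewrite (bigD1 i) //= (bigD1 j) ?[j == i]eq_sym //= tpermL tpermR.
rewrite [leRHS](bigD1 i) //= [X in _ <= _ + X](bigD1 j) ?[j == i]eq_sym //=.
rewrite (eq_bigr (fun l => z l * t l)) => [|l /andP[li lj]]; first by lra.
by rewrite tpermD // eq_sym.
Qed.

(** Cauchy-Schwarz with both bounds known in advance, so that no square roots enter. *)
Lemma row_pairing k (m n : 'I_k -> R) r rho : 0 <= r -> 0 < rho ->
  \sum_j m j ^+ 2 <= r ^+ 2 -> \sum_j n j ^+ 2 <= rho^-1 ^+ 2 ->
  \sum_j m j * n j <= r / rho.
Proof.
move=> r0 rho0 hm hn; move: r0; rewrite le_eqVlt => /predU1P[r0|r0].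
  rewrite -r0 expr0n /= in hm *; rewrite mul0r big1 // => j _.
  have /eqP : \sum_j m j ^+ 2 = 0.
    by apply: le_anti; rewrite hm sumr_ge0 // => i _; exact: sqr_ge0.
  rewrite psumr_eq0 => [/allP/(_ j)|i _]; last exact: sqr_ge0.
  by rewrite mem_index_enum => /(_ isT) /=; rewrite sqrf_eq0 => /eqP ->; rewrite mul0r.
(* Arithmetic and geometric means, weighted so that each of the two sums contributes at most
   [r / (2 * rho)]. *)
have le j : m j * n j <= (2 * r * rho)^-1 * m j ^+ 2 + (r * rho / 2) * n j ^+ 2.
  rewrite -subr_ge0.
  have -> : (2 * r * rho)^-1 * m j ^+ 2 + r * rho / 2 * n j ^+ 2 - m j * n j =
     (2 * r * rho)^-1 * (m j - r * rho * n j) ^+ 2.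
    by field; rewrite !gt_eqF.
  by rewrite mulr_ge0 ?sqr_ge0 // invr_ge0 !mulr_ge0 // ltW.
apply: le_trans (_ : _ <= \sum_j ((2 * r * rho)^-1 * m j ^+ 2 +
  (r * rho / 2) * n j ^+ 2)) _; first by apply: ler_sum => j _; exact: le.
rewrite big_split /= -!mulr_sumr.
have -> : r / rho = (2 * r * rho)^-1 * r ^+ 2 + (r * rho / 2) * rho^-1 ^+ 2.
  by field; rewrite !gt_eqF.
by apply: lerD; rewrite ler_wpM2l // ?invr_ge0 ?divr_ge0 ?mulr_ge0 // ltW.
Qed.

(* By symmetry of [a] the terms of (i, j) and (j, i) can be averaged, and
   similar ordering bounds [w i * s j + w j * s i] by [w i * s i + w j * s j]. *)
Lemma symmetric_rearrangement k (w s : 'I_k -> R) (a : 'I_k -> 'I_k -> R) e :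
  (forall i j, 0 <= a i j) -> (forall i j, a i j = a j i) ->
  (forall i, \sum_j a i j <= e) -> (forall i, 0 <= w i * s i) ->
  (forall i j, 0 <= (w i - w j) * (s i - s j)) ->
  \sum_i \sum_j w i * s j * a i j <= e * \sum_i w i * s i.
Proof.
move=> a0 aC ae ws0 ws.
have le : \sum_i \sum_j w i * s j * a i j <= \sum_i w i * s i * \sum_j a i j.
  have E1 : \sum_i w i * s i * \sum_j a i j = \sum_i \sum_j w i * s i * a i j.
    by apply: eq_bigr => i _; rewrite mulr_sumr.
  have E2 : \sum_i w i * s i * \sum_j a i j = \sum_i \sum_j w j * s j * a i j.
    rewrite E1 exchange_big; apply: eq_bigr => i _; apply: eq_bigr => j _.
    by rewrite aC.
  have E3 : \sum_i \sum_j w i * s j * a i j = \sum_i \sum_j w j * s i * a i j.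
    rewrite exchange_big; apply: eq_bigr => i _; apply: eq_bigr => j _.
    by rewrite aC.
  suff : \sum_i \sum_j w i * s j * a i j + \sum_i \sum_j w i * s j * a i j <=
    \sum_i w i * s i * \sum_j a i j + \sum_i w i * s i * \sum_j a i j by lra.
  rewrite {2}E3 {2}E2 E1 -!big_split; apply: ler_sum => i _ /=.
  rewrite -!big_split; apply: ler_sum => j _ /=.
  by have := mulr_ge0 (ws i j) (a0 i j); lra.
apply: le_trans le _; rewrite mulr_sumr; apply: ler_sum => i _.
by rewrite mulrC ler_wpM2r.
Qed.

(** The diagonal of the identity is paired with the support weights [z] of its left side. The first
    term leads to the sum of [symmetric_rearrangement] with [w = z / c], at most [r / rho] times the
    norm; the second contributes at most [N E]. *)
Lemma tan_pairing k (N : 'M[C]_k -> R) r rho (M K E : 'M[C]_k)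
    (s c : 'I_k -> R) :
  unitarily_invariant_norm N -> 0 <= r -> 0 < rho ->
  M ^t* = M -> K ^t* = K -> op_bound r M -> op_bound rho^-1 K ->
  (forall i, 0 <= s i) -> (forall i, 0 < c i) ->
  (forall i, s i ^+ 2 + c i ^+ 2 = 1) ->
  rdiag (fun i => s i / c i) =
    rdiag (fun i => (c i)^-1) *m M *m rdiag s *m K - E ->
  (rho - r) * N (rdiag (fun i => s i / c i)) <= rho * N E.
Proof.
move=> hN r0 rho0 MH KH Mr Kr s0 c0 sc eqn.
have t0 i : 0 <= s i / c i by rewrite divr_ge0 // ltW.
have [z [z0 zN zt zz]] := norm_support hN t0.
pose w i := z i / c i.
pose a i j := normc (M i j) * normc (K j i).
have nC (B : 'M[C]_k) i j : B ^t* = B -> normc (B i j) = normc (B j i).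
  move=> BH; rewrite -{1}BH !mxE; apply: complexI; exact: normcJ.
have aC i j : a i j = a j i by rewrite /a (nC M) // (nC K).
have a0 i j : 0 <= a i j by rewrite mulr_ge0 ?normc_ge0.
have ae i : \sum_j a i j <= r / rho.
  rewrite /a; under eq_bigr do rewrite (nC K) //.
  apply: row_pairing => //.
    by have := op_bound_row i Mr; rewrite /sqn; under eq_bigr do rewrite mxE.
  by have := op_bound_row i Kr; rewrite /sqn; under eq_bigr do rewrite mxE.
have sc_lt i j : s j < s i -> c i < c j.
  move=> h; have := sc i; have := sc j; have := s0 j; have := c0 j; have := c0 i.
  by move: h; clear; nra.
(* A larger sine has a smaller cosine, hence a larger tangent, hence a weight [z] at least as large;
   division by the cosine keeps this order. *)
have ws_lt i j : s j < s i -> 0 <= (w i - w j) * (s i - s j).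
  move=> h; have hc := sc_lt _ _ h.
  have hV : (c j)^-1 <= (c i)^-1 by rewrite lef_pV2 ?posrE // ltW.
  have tt : s j / c j < s i / c i.
    apply: le_lt_trans (_ : s j / c i < _); first by rewrite ler_wpM2l.
    by rewrite ltr_pM2r ?invr_gt0.
  have zji : z j <= z i.
    by have := zz i j; rewrite pmulr_lge0 ?subr_gt0 // subr_ge0.
  rewrite mulr_ge0 // subr_ge0; last exact: ltW.
  by apply: le_trans (ler_wpM2l (z0 j) hV) _; rewrite ler_wpM2r // invr_ge0 ltW.
have ws i j : 0 <= (w i - w j) * (s i - s j).
  case: (ltgtP (s i) (s j)) => [h|h|->]; last by rewrite subrr mulr0.
    by rewrite -mulrNN !opprB ws_lt.
  by rewrite ws_lt.
have ws0 i : 0 <= w i * s i by rewrite /w !mulr_ge0 // invr_ge0 ltW.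
have := symmetric_rearrangement a0 aC ae ws0 ws.
have -> : \sum_i w i * s i = N (rdiag (fun i => s i / c i)).
  by rewrite -zt; apply: eq_bigr => i _; rewrite /w mulrAC mulrA.
set NT := N _; move=> h.
suff h2 : NT <= \sum_i \sum_j w i * s j * a i j + N E.
  have : NT <= r / rho * NT + N E by apply: le_trans h2 _; rewrite lerD2r.
  move=> /(ler_wpM2l (ltW rho0)); rewrite mulrDr !mulrA.
  by rewrite (mulrC rho r) mulfK ?gt_eqF //; lra.
rewrite /NT -zt.
apply: le_trans (_ : _ <= \sum_i \sum_j w i * s j * a i j +
  \sum_i z i * normc (E i i)) _; last by rewrite lerD2l.
rewrite -big_split; apply: ler_sum => i _ /=.
have /matrixP/(_ i i) := eqn; rewrite [RHS]mxE [X in _ = _ + X]mxE => eqi.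
have -> : s i / c i = normc ((s i / c i)%:C%C : C) by rewrite normc_real ger0_norm.
have -> : (s i / c i)%:C%C = rdiag (fun i => s i / c i) i i :> C.
  by rewrite !mxE eqxx mulr1n.
rewrite eqi; set X := (_ *m K).
suff hX : z i * normc (X i i) <= \sum_j w i * s j * a i j.
  have : z i * normc (X i i - E i i) <= z i * (normc (X i i) + normc (E i i)).
    by rewrite ler_wpM2l //; apply: le_trans (le_normcD _ _) _; rewrite normcN.
  by rewrite mulrDr; move: hX; lra.
rewrite /X mxE; apply: le_trans (ler_wpM2l (z0 i) (normc_sum _)) _.
rewrite mulr_sumr; apply: ler_sum => j _.
rewrite mulmx_rdiagE mul_rdiagE !Normc.normcM !normc_real.
rewrite (ger0_norm (s0 j)) ger0_norm ?invr_ge0 ?(ltW (c0 i)) //.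
by rewrite /w /a le_eqVlt; apply/orP; left; apply/eqP; ring.
Qed.

(** * The tangent theorem in an adapted basis *)

Lemma sqn_row_rdiag m n (A : 'M[C]_(m, n)) (s : 'I_m -> R) i :
  A *m A ^t* = rdiag s -> sqn (row i A) = s i.
Proof. by move=> AA; apply: complexI; rewrite sqn_row AA !mxE eqxx mulr1n. Qed.

(** [H] is taken already shifted, so the spectrum of [L] lies in [[- r, r]]; [V] stands for a basis
    of the complement of the invariant subspace, and [K] inverts the compression to [W]. *)
Lemma tan_theta d p k q (N : 'M[C]_d -> R) (H : 'M[C]_p) (L : 'M[C]_q)
    (V : 'M[C]_(p, q)) (W : 'M[C]_(p, k)) (K : 'M[C]_k) (c : 'I_k -> R) r rho :
  unitarily_invariant_norm N -> (k <= p)%N -> (p <= d)%N ->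
  V ^t* *m V = 1%:M -> W ^t* *m W = 1%:M -> L ^t* = L ->
  V ^t* *m H = L *m V ^t* -> W ^t* *m H *m W *m K = 1%:M -> K ^t* = K ->
  op_bound r L -> op_bound rho^-1 K -> 0 <= r -> r < rho ->
  (forall i, 0 <= c i) ->
  W ^t* *m V *m V ^t* *m W = rdiag (fun i => 1 - c i ^+ 2) ->
  (forall i, 0 < c i) /\
  (rho - r) * N (pad d (rdiag (fun i => Num.sqrt (1 - c i ^+ 2) / c i))) <=
    N (pad d (residual H W)).
Proof.
move=> hN kp pd VV WW LH VH WK KH Lr Kr r0 rrho c0 WVVW.
have rho0 : 0 < rho by apply: le_lt_trans rrho.
have kd := leq_trans kp pd.
set Rs := residual H W; pose A1 := W ^t* *m H *m W.
have RE : Rs = H *m W - W *m A1 by [].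
have A1E : A1 = W ^t* *m H *m W by []; rewrite -A1E in WK.
move: Rs A1 RE A1E WK => Rs A1 RE A1E WK.
pose Z := V ^t* *m W; have ZW : V ^t* *m W = Z by [].
have ZE : Z ^t* = W ^t* *m V by rewrite adjmxM trmxCK.
have ZZ : Z ^t* *m Z = rdiag (fun i => 1 - c i ^+ 2) by rewrite ZE mulmxA.
have c1 i : 0 <= 1 - c i ^+ 2.
  have := sqn_row_rdiag (A := Z ^t*) i; rewrite trmxCK => /(_ _ ZZ) <-.
  exact: sqn_ge0.
pose s i := Num.sqrt (1 - c i ^+ 2).
have s0 i : 0 <= s i by exact: sqrtr_ge0.
have ss i : s i ^+ 2 = 1 - c i ^+ 2 by rewrite sqr_sqrtr.
have {}ZZ : Z ^t* *m Z = rdiag (fun i => s i ^+ 2).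
  by rewrite ZZ; apply: eq_rdiag => i.
have Zb : op_bound 1 (Z ^t*).
  rewrite ZE -[1](mulr1 1); apply: op_boundM; last exact: op_bound_isometry.
  by apply: op_bound_coisometry; rewrite trmxCK.
have Zb' : op_bound 1 Z.
  rewrite -[1](mulr1 1); apply: op_boundM; last exact: op_bound_isometry.
  by apply: op_bound_coisometry; rewrite trmxCK.
clearbody Z.
(* The Sylvester equation for [Z], whose coefficients [L] and [A1] have separated spectra. *)
have VR : V ^t* *m Rs = L *m Z - Z *m A1.
  by rewrite RE mulmxBr !mulmxA VH ZW -!mulmxA ZW.
have WR : W ^t* *m Rs = 0.
  by rewrite RE mulmxBr !mulmxA WW mul1mx -A1E subrr.
(* This is [Z ^t* *m V ^t*] with its component along [W] removed. The product with [Rs], which is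
   orthogonal to [W], does not change, and the rows become orthogonal of lengths [s i * c i]. *)
pose J0 := Z ^t* *m V ^t* - rdiag (fun i => s i ^+ 2) *m W ^t*.
have J0R : J0 *m Rs = Z ^t* *m L *m Z - rdiag (fun i => s i ^+ 2) *m A1.
  rewrite mulmxBl -!mulmxA VR WR mulmx0 subr0 mulmxBr !mulmxA ZZ.
  by rewrite -!mulmxA.
have J0J0 : J0 *m J0 ^t* = rdiag (fun i => (s i * c i) ^+ 2).
  rewrite adjmxB !adjmxM adj_rdiag !trmxCK mulmxBl !mulmxBr.
  have -> : Z ^t* *m V ^t* *m (V *m Z) = rdiag (fun i => s i ^+ 2).
    by rewrite mulmxA -(mulmxA _ _ V) VV mulmx1 ZZ.
  have -> : Z ^t* *m V ^t* *m (W *m rdiag (fun i => s i ^+ 2)) =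
      rdiag (fun i => s i ^+ 2 * s i ^+ 2).
    by rewrite mulmxA -(mulmxA _ (V ^t*)) ZW ZZ rdiagM.
  have -> : rdiag (fun i => s i ^+ 2) *m W ^t* *m (V *m Z) =
      rdiag (fun i => s i ^+ 2 * s i ^+ 2).
    by rewrite -mulmxA (mulmxA (W ^t*)) -ZE ZZ rdiagM.
  have -> : rdiag (fun i => s i ^+ 2) *m W ^t* *m (W *m rdiag (fun i => s i ^+ 2)) =
      rdiag (fun i => s i ^+ 2 * s i ^+ 2).
    by rewrite mulmxA -(mulmxA _ _ W) WW mulmx1 rdiagM.
  rewrite subrr subr0 -raddfB /=; congr diag_mx; apply/rowP => i.
  by rewrite !mxE -rmorphB /=; congr (_%:C)%C; rewrite exprMn ss; ring.
clearbody J0.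
(* If [c i = 0], then [s i = 1] and row [i] of [J0] is zero, so row [i] of [Z ^t* *m L *m Z *m K] is
   a unit vector, although its length is at most [r / rho < 1]. *)
have cp i : 0 < c i.
  rewrite lt_neqAle c0 andbT eq_sym; apply/eqP => ci.
  have si : s i ^+ 2 = 1 by rewrite ss ci expr0n subr0.
  have : row i J0 = 0.
    by apply: sqn_eq0; rewrite (sqn_row_rdiag i J0J0) ci mulr0 expr0n.
  move=> /(congr1 (mulmx^~ Rs)); rewrite -row_mul J0R mul0mx => /rowP rE.
  have E : row i (Z ^t* *m L *m Z) = row i A1.
    apply/rowP => j; have := rE j; rewrite [LHS]mxE [X in X = _]mxE [X in _ + X]mxE.
    by rewrite mul_rdiagE si mul1r !mxE => /eqP; rewrite subr_eq0 => /eqP.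
  have := congr1 (mulmx^~ K) E; rewrite -!row_mul WK => E1.
  have := op_bound_row i (op_boundM (op_boundM (op_boundM Zb Lr) Zb') Kr).
  rewrite E1 mul1r mulr1 (sqn_row_rdiag (s := fun=> 1)); last first.
    by rewrite mul1mx adjmx1 rdiag1.
  have : r / rho < 1 by rewrite ltr_pdivrMr // mul1r.
  have : 0 <= r / rho by rewrite divr_ge0 // ltW.
  nra.
split=> //.
(* Normalising the rows of [J0] gives a partial isometry: rows with [s i = 0] stay zero because the
   inverse of 0 is 0. *)
pose J := rdiag (fun i => (s i * c i)^-1) *m J0.
have Jb : op_bound 1 J.
  apply: op_bound_partial_isometry.
  have -> : J *m J ^t* = rdiag (fun i => if s i == 0 then 0 else 1).
    rewrite adjmxM adj_rdiag mulmxA -(mulmxA _ J0) J0J0 !rdiagM.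
    apply: eq_rdiag => i; have [->|si] := eqVneq (s i) 0.
      by rewrite mul0r invr0 !mul0r.
    by field; rewrite si gt_eqF.
  rewrite /J mulmxA rdiagM; congr (_ *m J0); apply: eq_rdiag => i.
  by case: eqP => [->|_]; rewrite ?mul0r ?invr0 ?mul0r ?mul1r.
(* [Z = G *m rdiag s] is a polar decomposition, with the same convention at [s i = 0]. It turns [L]
   into the Hermitian [M] of size [k]. *)
pose G := Z *m rdiag (fun i => (s i)^-1).
have GE : G ^t* = rdiag (fun i => (s i)^-1) *m Z ^t* by rewrite adjmxM adj_rdiag.
have GGG : G ^t* *m G *m G ^t* = G ^t*.
  have -> : G ^t* *m G = rdiag (fun i => (s i)^-1 * s i ^+ 2 * (s i)^-1).
    by rewrite GE /G mulmxA -(mulmxA _ (Z ^t*)) ZZ !rdiagM.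
  rewrite GE mulmxA rdiagM.
  congr (_ *m Z ^t*); apply: eq_rdiag => i.
  have [->|si] := eqVneq (s i) 0; first by rewrite invr0 !mulr0.
  by field; rewrite si.
have Gb : op_bound 1 (G ^t*).
  by apply: op_bound_partial_isometry; rewrite trmxCK.
have Gb' : op_bound 1 G.
  apply: op_bound_partial_isometry; have := congr1 (fun M => M ^t*) GGG.
  by rewrite !adjmxM !trmxCK mulmxA.
have sG : rdiag s *m G ^t* = Z ^t*.
  rewrite GE mulmxA rdiagM; apply: (gram_rdiag_id (s := fun i => s i ^+ 2)).
    by rewrite trmxCK.
  by move=> i; rewrite sqrf_eq0 => si; rewrite divff.
have Gs : G *m rdiag s = Z.
  by have := congr1 (fun M => M ^t*) sG; rewrite adjmxM adj_rdiag !trmxCK.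
clearbody G; pose M := G ^t* *m L *m G.
have MH : M ^t* = M by rewrite /M !adjmxM trmxCK LH mulmxA.
have Mb : op_bound r M.
  have -> : r = 1 * r * 1 by rewrite mul1r mulr1.
  by apply: op_boundM => //; apply: op_boundM.
(* The rows of [J0R] are divided by [s i * c i] and multiplied by [K]; since [A1 *m K] is the
   identity, the last term becomes the diagonal of tangents. *)
have eqn : rdiag (fun i => s i / c i) =
    rdiag (fun i => (c i)^-1) *m M *m rdiag s *m K - J *m Rs *m K.
  have -> : J *m Rs *m K = rdiag (fun i => (c i)^-1) *m M *m rdiag s *m K -
      rdiag (fun i => s i / c i); last by rewrite opprB addrC subrK.
  have scG : rdiag (fun i => (s i * c i)^-1) *m Z ^t* =
      rdiag (fun i => (c i)^-1) *m G ^t*.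
    rewrite GE mulmxA rdiagM; congr (_ *m Z ^t*).
    by apply: eq_rdiag => i; rewrite invfM mulrC.
  rewrite /J -(mulmxA _ J0) J0R mulmxBr mulmxBl.
  have -> : rdiag (fun i => (s i * c i)^-1) *m (Z ^t* *m L *m Z) *m K =
      rdiag (fun i => (c i)^-1) *m M *m rdiag s *m K.
    by rewrite /M !mulmxA scG -(mulmxA (_ *m L) G) Gs.
  congr (_ - _); rewrite mulmxA rdiagM -mulmxA WK mulmx1; apply: eq_rdiag => i.
  have [->|si] := eqVneq (s i) 0; first by rewrite !mul0r expr0n mulr0.
  by field; rewrite si gt_eqF.
have hNk := pad_invariant_norm kd hN.
have sc i : s i ^+ 2 + c i ^+ 2 = 1 by rewrite ss subrK.
have := tan_pairing hNk r0 rho0 MH KH Mb Kr s0 cp sc eqn.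
move=> /le_trans; apply; rewrite -ler_pdivlMl //.
have rhoV0 : 0 <= rho^-1 by rewrite invr_ge0 ltW.
apply: le_trans (norm_pad_boundr (J *m Rs) hN rhoV0 kd Kr) _.
by rewrite ler_wpM2l //; have := norm_pad_boundl Rs hN ler01 pd Jb; rewrite mul1r.
Qed.

(** * Eigenvalues and orthonormal bases *)

Lemma char_poly_unitary_conj n (U D : 'M[C]_n) : U ^t* *m U = 1%:M ->
  char_poly (U ^t* *m D *m U) = char_poly D.
Proof.
move=> UU; rewrite /char_poly.
have -> : char_poly_mx (U ^t* *m D *m U) =
    map_mx polyC (U ^t*) *m char_poly_mx D *m map_mx polyC U.
  rewrite /char_poly_mx mulmxBr mulmxBl -!map_mxM; congr (_ - _).
  rewrite mul_mx_scalar -scalemxAl -map_mxM UU map_mx1.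
  by rewrite scalemx1.
rewrite !det_mulmx mulrAC -det_mulmx -map_mxM UU map_mx1 det1.
by rewrite mul1r.
Qed.

(** The diagonal of a unitary diagonalisation and [lambda A] both list the roots of the
    characteristic polynomial; the permutation between them is absorbed into [U]. *)
Lemma hermitian_lambda n (A : 'M[C]_n) : A ^t* = A ->
  exists2 U : 'M[C]_n, U *m U ^t* = 1%:M &
    A = U ^t* *m rdiag (fun i => lambda A i) *m U.
Proof.
move=> AH; have [U [s /unitarymxP UU AE]] := hermitian_diag AH.
set L := sval (closed_field_poly_normal (char_poly A)).
have LE : perm_eq L [seq (s i)%:C%C | i : 'I_n].
  apply: prod_XsubC_eq.
  have : char_poly A = lead_coef (char_poly A) *: \prod_(z <- L) ('X - z%:P).
    exact: svalP (closed_field_poly_normal (char_poly A)).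
  rewrite (monicP (char_poly_monic A)) scale1r => <-.
  rewrite AE char_poly_unitary_conj; last exact: mulmx1C.
  rewrite char_poly_trig ?big_map ?big_enum /=; last first.
    by apply/is_trig_mxP => i j ij; rewrite !mxE -val_eqE ltn_eqF.
  by apply: eq_bigr => i _; rewrite !mxE eqxx mulr1n.
have SE : perm_eq (sort >=%R [seq complex.Re z | z <- L]) [tuple s i | i < n].
  rewrite perm_sort; apply: perm_trans (perm_map _ LE) _.
  by rewrite -map_comp /=.
have [u uE] := tuple_permP SE.
have lE (i : 'I_n) : lambda A i = s (u i).
  by rewrite /lambda -/L uE -tnth_nth !tnth_mktuple.
exists (perm_mx u *m U).
  by rewrite adjmxM mulmxA -(mulmxA _ U) UU mulmx1 adj_perm_mx -perm_mxM mulgV perm_mx1.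
rewrite (eq_rdiag lE) (rdiag_perm u s) adjmxM adj_perm_mx !mulmxA.
have pp : perm_mx u^-1 *m perm_mx u = 1%:M :> 'M[C]_n.
  by rewrite -perm_mxM mulVg perm_mx1.
by rewrite -(mulmxA (U ^t*)) pp mulmx1 -(mulmxA (_ *m rdiag s)) pp mulmx1.
Qed.

(** Each eigenvalue of the compression is a convex combination of those of [B]: [T] compares the two
    eigenbases, and the squared moduli in each of its rows sum to 1. *)
Lemma lambda_compression n m (B : 'M[C]_n) (G : 'M[C]_(n, m)) (a b : R) :
  B ^t* = B -> G ^t* *m G = 1%:M ->
  (forall i, (i < n)%N -> a <= lambda B i <= b) ->
  forall i, (i < m)%N -> a <= lambda (G ^t* *m B *m G) i <= b.
Proof.
move=> BH GG hB j jm; set D := G ^t* *m B *m G.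
have DH : D ^t* = D by rewrite /D !adjmxM trmxCK BH mulmxA.
have [P PP BE] := hermitian_lambda BH.
have [Q QQ DE] := hermitian_lambda DH.
pose T := Q *m G ^t* *m P ^t*.
have TT : T *m T ^t* = 1%:M.
  rewrite /T !adjmxM !trmxCK -!mulmxA (mulmxA _ P) (mulmx1C PP) mul1mx.
  by rewrite (mulmxA _ G) GG mul1mx.
have TBT : T *m rdiag (fun i => lambda B i) *m T ^t* = rdiag (fun i => lambda D i).
  rewrite /T !adjmxM !trmxCK.
  have -> : rdiag (fun i => lambda D i) = Q *m D *m Q ^t*.
    by rewrite {2}DE !mulmxA QQ mul1mx -mulmxA QQ mulmx1.
  by rewrite /D {2}BE !mulmxA.
clearbody T; pose i := Ordinal jm.
have lE : lambda D i = \sum_l normc (T i l) ^+ 2 * lambda B l.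
  apply: complexI; have /matrixP/(_ i i) := TBT.
  rewrite [RHS]mxE !mxE eqxx mulr1n => <-; rewrite rmorph_sum.
  apply: eq_bigr => l _; rewrite mulmx_rdiagE !mxE mulrAC.
  by rewrite rmorphM /= -mulCJ.
have T1 : \sum_l normc (T i l) ^+ 2 = 1.
  have := sqn_row_rdiag (A := T) (s := fun=> 1) i; rewrite TT rdiag1 => /(_ erefl) <-.
  by apply: eq_bigr => l _; rewrite mxE.
have w0 l : 0 <= normc (T i l) ^+ 2 by exact: sqr_ge0.
change (a <= lambda D i <= b); rewrite lE -[a]mul1r -[b]mul1r -T1 !mulr_suml.
by apply/andP; split; apply: ler_sum => l _; rewrite ler_wpM2l //;
  case/andP: (hB l (ltn_ord l)).
Qed.

Lemma hermitian_shift n (A : 'M[C]_n) (c : R) : A ^t* = A ->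
  exists2 U : 'M[C]_n, U *m U ^t* = 1%:M &
    A - (c%:C%C)%:M = U ^t* *m rdiag (fun i => lambda A i - c) *m U.
Proof.
move=> AH; have [U UU AE] := hermitian_lambda AH; exists U => //.
have -> : rdiag (fun i => lambda A i - c) =
    rdiag (fun i => lambda A i) - (c%:C%C)%:M :> 'M[C]_n.
  apply/matrixP => i j; rewrite !mxE rmorphB /=.
  by case: eqP; rewrite ?mulr1n ?mulr0n ?subr0.
rewrite mulmxBr mulmxBl -AE mul_mx_scalar -scalemxAl (mulmx1C UU).
by rewrite scalemx1.
Qed.

Lemma op_bound_conj n (U : 'M[C]_n) (s : 'I_n -> R) c : U *m U ^t* = 1%:M ->
  (forall i, `|s i| <= c) -> op_bound c (U ^t* *m rdiag s *m U).
Proof.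
move=> UU sc; rewrite -[c]mul1r -[1 * c]mulr1; apply: op_boundM.
  apply: op_boundM; last exact: op_bound_rdiag.
  by apply: op_bound_isometry; rewrite trmxCK.
exact: op_bound_coisometry.
Qed.

Lemma op_bound_lambda n (A : 'M[C]_n) c r : A ^t* = A ->
  (forall i, (i < n)%N -> `|lambda A i - c| <= r) ->
  op_bound r (A - (c%:C%C)%:M).
Proof.
move=> AH h; have [U UU ->] := hermitian_shift c AH.
by apply: op_bound_conj => // i; apply: h.
Qed.

Lemma inverse_lambda n (A : 'M[C]_n) c rho : A ^t* = A -> 0 < rho ->
  (forall i, (i < n)%N -> rho <= `|lambda A i - c|) ->
  exists K : 'M[C]_n, [/\ K ^t* = K, op_bound rho^-1 K &
    (A - (c%:C%C)%:M) *m K = 1%:M].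
Proof.
move=> AH rho0 h; have [U UU ->] := hermitian_shift c AH.
have h' (i : 'I_n) : rho <= `|lambda A i - c| by apply: h.
exists (U ^t* *m rdiag (fun i => (lambda A i - c)^-1) *m U); split.
- by rewrite !adjmxM adj_rdiag trmxCK mulmxA.
- apply: op_bound_conj => // i.
  by rewrite normfV lef_pV2 ?posrE // (lt_le_trans rho0).
rewrite !mulmxA -(mulmxA _ U) UU mulmx1 -(mulmxA (U ^t*)) rdiagM.
rewrite (@eq_rdiag _ _ (fun=> 1)) ?rdiag1 ?mulmx1 ?(mulmx1C UU) // => i.
by rewrite divff // -normr_gt0 (lt_le_trans rho0).
Qed.

(** * Orthogonal complements and changes of orthonormal basis *)

Lemma orthoc_disjoint n (V : {vspace 'cV[C]_n}) : (V :&: orthoc V = 0)%VS.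
Proof.
apply/eqP; rewrite -subv0; apply/subvP => v; rewrite memv_cap memv0.
case/andP => vV /orthocP/(_ _ vV) vv.
have : v ^t* = 0 by apply: mulmx_adj_eq0; rewrite trmxCK.
by move=> /(congr1 (fun M => M ^t*)); rewrite trmxCK adjmx0 => ->.
Qed.

Lemma is_onb_memM n k m (Q : 'M[C]_(n, k)) V (x : 'M[C]_(k, m)) i :
  is_onb Q V -> col i (Q *m x) \in V.
Proof.
by move=> QV; apply/(is_onb_mem _ QV); exists (col i x); rewrite !colE mulmxA.
Qed.

Lemma onb_proj n k (Q : 'M[C]_(n, k)) V v :
  is_onb Q V -> v \in V -> Q *m Q ^t* *m v = v.
Proof.
move=> QV /(is_onb_mem _ QV)[x ->].
by rewrite mulmxA -(mulmxA Q) QV.1 mulmx1.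
Qed.

Lemma onb_proj_compl n k (Q : 'M[C]_(n, k)) V v :
  is_onb Q V -> v - Q *m Q ^t* *m v \in orthoc V.
Proof.
move=> QV; apply/orthocP => u /(is_onb_mem _ QV)[x ->].
by rewrite adjmxM -mulmxA mulmxBr !mulmxA QV.1 mul1mx subrr mulmx0.
Qed.

Lemma dim_orthoc n (V : {vspace 'cV[C]_n}) : \dim (orthoc V) = (n - \dim V)%N.
Proof.
have QV := onb_ofP (erefl (\dim V)).
suff nE : (\dim V + \dim (orthoc V))%N = n by lia.
rewrite -(dimv_disjoint_sum (orthoc_disjoint V)).
suff -> : (V + orthoc V = fullv)%VS by rewrite dimvf; apply: muln1.
apply/eqP; rewrite eqEsubv subvf; apply/subvP => v _.
rewrite -(subrK (onb_of (\dim V) V *m (onb_of (\dim V) V) ^t* *m v) v) addrC.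
apply: memv_add; last exact: onb_proj_compl QV.
by rewrite -mulmxA; apply/(is_onb_mem _ QV); eexists.
Qed.

Lemma onb_orthoc_mul n k l (Q : 'M[C]_(n, k)) (P : 'M[C]_(n, l)) V :
  is_onb Q V -> is_onb P (orthoc V) -> P ^t* *m Q = 0.
Proof.
move=> QV PV; rewrite -[LHS]trmxCK adjmxM trmxCK.
suff -> : Q ^t* *m P = 0 by rewrite adjmx0.
apply/matrixP => i j; have := is_onb_memM 1%:M j PV; rewrite mulmx1 => /orthocP.
have := is_onb_memM 1%:M i QV; rewrite mulmx1 => iQ /(_ _ iQ).
move=> /matrixP/(_ 0 0); rewrite !mxE => E; rewrite -[RHS]E.
by apply: eq_bigr => m _; rewrite !mxE.
Qed.

Lemma onb_orthoc_proj n k l (Q : 'M[C]_(n, k)) (P : 'M[C]_(n, l)) V :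
  is_onb Q V -> is_onb P (orthoc V) -> P *m P ^t* = 1%:M - Q *m Q ^t*.
Proof.
move=> QV PV; apply/matrixP => i j.
have := onb_proj PV (onb_proj_compl (delta_mx j 0) QV).
rewrite mulmxBr !mulmxA -(mulmxA P _ Q) (onb_orthoc_mul QV PV) mulmx0 !mul0mx subr0.
rewrite -{2}[delta_mx j 0]mul1mx -mulmxBl -!colE.
by move=> /matrixP/(_ i 0); rewrite !mxE.
Qed.

Lemma onb_mulmx_unitary n k (Q : 'M[C]_(n, k)) V (U : 'M[C]_k) :
  is_onb Q V -> U *m U ^t* = 1%:M -> is_onb (Q *m U) V.
Proof.
move=> QV UU; have UU' := mulmx1C UU; apply: is_onbP => [|v].
  by rewrite adjmxM mulmxA -(mulmxA _ _ Q) QV.1 mulmx1.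
split=> [/(is_onb_mem _ QV)[x ->]|[x ->]].
  by exists (U ^t* *m x); rewrite mulmxA -(mulmxA Q) UU mulmx1.
by apply/(is_onb_mem _ QV); exists (U *m x); rewrite mulmxA.
Qed.

(** * Passing to coordinates in an orthonormal frame of a larger subspace *)

Section Frame.
Variables (d p : nat) (S : 'M[C]_(d, p)) (T X : {vspace 'cV[C]_d}).
Hypotheses (hS : is_onb S T) (XT : (X <= T)%VS).

Lemma frame_proj k (Q : 'M[C]_(d, k)) : is_onb Q X -> S *m S ^t* *m Q = Q.
Proof.
move=> QX; apply/matrixP => i j.
have := is_onb_memM 1%:M j QX; rewrite mulmx1 => /(subvP XT)/(onb_proj hS).
rewrite colE mulmxA -!colE => E.
have <- : col j (S *m S ^t* *m Q) i 0 = (S *m S ^t* *m Q) i j by rewrite mxE.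
by rewrite E mxE.
Qed.

Lemma onb_mximage k (Q : 'M[C]_(d, k)) :
  is_onb Q X -> is_onb (S ^t* *m Q) (mximage (S ^t*) X).
Proof.
move=> QX; apply: is_onbP => [|v].
  by rewrite adjmxM trmxCK -mulmxA (mulmxA S) frame_proj // QX.1.
split=> [/mem_mximage[w /(is_onb_mem _ QX)[x ->] ->]|[x ->]].
  by exists x; rewrite mulmxA.
apply/mem_mximage; exists (Q *m x); rewrite ?mulmxA //.
by apply/(is_onb_mem _ QX); exists x.
Qed.

Lemma onb_of_mximage k (Q : 'M[C]_(p, k)) :
  is_onb Q (mximage (S ^t*) X) -> is_onb (S *m Q) X.
Proof.
move=> QX; apply: is_onbP => [|v].
  by rewrite adjmxM mulmxA -(mulmxA _ _ S) hS.1 mulmx1 QX.1.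
split=> [vX|[x ->]].
  have : S ^t* *m v \in mximage (S ^t*) X by apply/mem_mximage; exists v.
  move=> /(is_onb_mem _ QX)[x xE]; exists x.
  by rewrite -mulmxA -xE mulmxA (onb_proj hS) // (subvP XT).
have : Q *m x \in mximage (S ^t*) X by apply/(is_onb_mem _ QX); exists x.
case/mem_mximage => w wX wE; rewrite -mulmxA wE mulmxA (onb_proj hS) //.
exact: (subvP XT).
Qed.

End Frame.

Lemma residual_mul_unitary n k (A : 'M[C]_n) (Q : 'M[C]_(n, k)) (U : 'M[C]_k) :
  U *m U ^t* = 1%:M -> residual A (Q *m U) = residual A Q *m U.
Proof.
move=> UU; rewrite /residual mulmxBl adjmxM !mulmxA; congr (_ - _).
by rewrite -(mulmxA Q) UU mulmx1.
Qed.

Lemma residual_shift n k (A : 'M[C]_n) (Q : 'M[C]_(n, k)) (c : C) :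
  Q ^t* *m Q = 1%:M -> residual (A - c%:M) Q = residual A Q.
Proof.
move=> QQ; rewrite /residual mulmxBl mulmxBr mulmxBl mulmxBr.
rewrite mul_scalar_mx mul_mx_scalar -scalemxAl QQ scalemx1 mul_mx_scalar.
by rewrite opprB addrA subrK.
Qed.

(** * Separation and the tangent bound *)

(** Valid also at [x = 0], where both sides are quotients by 0 and equal 0. *)
Lemma tan_acos (x : R) : -1 <= x <= 1 -> tan (acos x) = Num.sqrt (1 - x ^+ 2) / x.
Proof. by move=> hx; rewrite /tan sin_acos // acosK. Qed.

Lemma DKN_separation_frame d k p (A : 'M[C]_d) (X Y T : {vspace 'cV[C]_d})
    (S : 'M[C]_(d, p)) (delta : R) :
  is_onb S T -> (X <= T)%VS -> (Y <= T)%VS ->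
  DKN_separation k A X Y delta ->
  DKN_separation k (S ^t* *m A *m S) (mximage (S ^t*) X) (mximage (S ^t*) Y) delta.
Proof.
move=> hS XT YT [/hermsymmxP AH dX dY AX sep].
have QX := onb_ofP dX; set Q := onb_of k X in QX.
split.
- by apply/hermsymmxP; rewrite !adjmxM trmxCK AH mulmxA.
- exact: is_onb_dim (onb_mximage hS XT QX).
- exact: is_onb_dim (onb_mximage hS YT (onb_ofP dY)).
- apply/subvP => _ /mem_mximage[_ /mem_mximage[v vX ->] ->].
  apply/mem_mximage; exists (A *m v).
    by apply: (subvP AX); apply/mem_mximage; exists v.
  by rewrite -!mulmxA (mulmxA S) (onb_proj hS) // (subvP XT).
move=> Vp Wm hVp hWm.
have dXo : \dim (orthoc X) = (d - k)%N by rewrite dim_orthoc dX.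
have PX := onb_ofP dXo; set P := onb_of (d - k) (orthoc X) in PX.
have [a [b [ab hV hW]]] := sep _ _ PX (onb_of_mximage hS YT hWm).
exists a, b; split; [exact: ab | move=> i ik | move=> i ik]; last first.
  by have := hW i ik; rewrite adjmxM !mulmxA.
(* The columns of [S *m Vp] are orthogonal to [X], and [G] holds their coordinates in the basis [P].
   It is an isometry, so the compression to [Vp] is a compression of the one to [P]. *)
pose G := P ^t* *m S *m Vp.
have QVp : Q ^t* *m S *m Vp = 0.
  have := onb_orthoc_mul (onb_mximage hS XT QX) hVp.
  move=> /(congr1 (fun M => M ^t*)); rewrite !adjmxM !trmxCK => ->.
  exact: adjmx0.
have PG : P *m G = S *m Vp.
  rewrite /G !mulmxA (onb_orthoc_proj QX PX) !mulmxBl mul1mx.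
  by rewrite -!mulmxA (mulmxA (Q ^t*)) QVp mulmx0 subr0.
clearbody G; have GG : G ^t* *m G = 1%:M.
  have -> : G ^t* *m G = (P *m G) ^t* *m (P *m G).
    by rewrite adjmxM mulmxA -(mulmxA _ _ P) PX.1 mulmx1.
  by rewrite PG adjmxM mulmxA -(mulmxA _ _ S) hS.1 mulmx1 hVp.1.
have PAP : (P ^t* *m A *m P) ^t* = P ^t* *m A *m P.
  by rewrite !adjmxM trmxCK AH mulmxA.
have := lambda_compression PAP GG hV ik.
have -> : G ^t* *m (P ^t* *m A *m P) *m G = (P *m G) ^t* *m A *m (P *m G).
  by rewrite adjmxM !mulmxA.
by rewrite PG adjmxM !mulmxA.
Qed.

Lemma DKN_tan_bound d k p (A : 'M[C]_d) (X Y T : {vspace 'cV[C]_d})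
    (S : 'M[C]_(d, p)) (Ym : 'M[C]_(d, k)) (delta : R) (N : 'M[C]_d -> R) :
  is_onb S T -> (X <= T)%VS -> (Y <= T)%VS -> (p <= d)%N ->
  \dim X = k -> \dim Y = k -> is_onb Ym Y -> 0 < delta ->
  DKN_separation k (S ^t* *m A *m S) (mximage (S ^t*) X) (mximage (S ^t*) Y) delta ->
  unitarily_invariant_norm N ->
  delta * N (pad d (diag_tan (@principal_angle R d k X Y))) <=
    N (pad d (residual (S ^t* *m A *m S) (S ^t* *m Ym))).
Proof.
move=> hS XT YT pd dX dY hYm delta0 [/hermsymmxP HH dXS dYS HX sep] hN.
set H := S ^t* *m A *m S in HH HX sep *; clearbody H.
have kp : (k <= p)%N by rewrite -(is_onb_dim hS) -dX dimvS.
have QX := onb_ofP dX; set Xo := onb_of k X in QX.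
have YoY := onb_ofP dY; set Yo := onb_of k Y in YoY.
have QXS := onb_mximage hS XT QX; set Q := S ^t* *m Xo in QXS.
have dXSo : \dim (orthoc (mximage (S ^t*) X)) = (p - k)%N by rewrite dim_orthoc dXS.
have VX := onb_ofP dXSo; move: (onb_of _ _) VX => V VX.
have [Mc McE] : {M | M = Xo ^t* *m Yo} by exists (Xo ^t* *m Yo).
(* Squared cosines of the principal angles, in non-increasing order. *)
pose l := lambda (Mc ^t* *m Mc).
have McH : (Mc ^t* *m Mc) ^t* = Mc ^t* *m Mc by rewrite adjmxM trmxCK.
have [U UU ME] := hermitian_lambda McH.
have McU : (Mc *m U ^t*) ^t* *m (Mc *m U ^t*) = rdiag (fun i : 'I_k => l i).
  rewrite adjmxM trmxCK mulmxA -(mulmxA U) ME !mulmxA UU mul1mx.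
  by rewrite -mulmxA UU mulmx1.
(* Turning [Yo] by the eigenvectors of [Mc ^t* *m Mc] makes the Gram matrix of [Q ^t* *m W]
   diagonal. *)
pose W := S ^t* *m Yo *m U ^t*.
have UU' : U ^t* *m U ^t* ^t* = 1%:M by rewrite trmxCK (mulmx1C UU).
have WY : is_onb W (mximage (S ^t*) Y).
  exact: onb_mulmx_unitary (onb_mximage hS YT YoY) UU'.
have QW : Q ^t* *m W = Mc *m U ^t*.
  rewrite /Q /W McE adjmxM trmxCK !mulmxA -(mulmxA _ S) -(mulmxA _ _ Yo).
  by rewrite (frame_proj hS YT YoY).
clearbody Q W.
have VV := onb_orthoc_proj QXS VX.
have WVVW0 : W ^t* *m V *m V ^t* *m W = rdiag (fun i => 1 - l i).
  rewrite -(mulmxA _ V) VV mulmxBr mulmxBl mulmx1 WY.1.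
  have -> : W ^t* *m (Q *m Q ^t*) *m W = (Q ^t* *m W) ^t* *m (Q ^t* *m W).
    by rewrite adjmxM trmxCK !mulmxA.
  rewrite QW McU -rdiag1 -raddfB /=; congr diag_mx.
  by apply/rowP => i; rewrite !mxE rmorphB.
have l0 (i : 'I_k) : 0 <= l i.
  have := sqn_row_rdiag (A := (Mc *m U ^t*) ^t*) i.
  by rewrite trmxCK => /(_ _ McU) <-; exact: sqn_ge0.
pose c (i : 'I_k) := Num.sqrt (l i).
have c2 i : c i ^+ 2 = l i by rewrite sqr_sqrtr.
have c0 i : 0 <= c i by exact: sqrtr_ge0.
have WVVW : W ^t* *m V *m V ^t* *m W = rdiag (fun i => 1 - c i ^+ 2).
  by rewrite WVVW0; apply: eq_rdiag => i; rewrite c2.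
have c1 i : c i <= 1.
  have := sqn_row_rdiag (A := W ^t* *m V) (s := fun i => 1 - c i ^+ 2) i.
  rewrite adjmxM trmxCK mulmxA => /(_ WVVW); have := sqn_ge0 (row i (W ^t* *m V)).
  move=> /[swap] ->; rewrite subr_ge0 => h.
  by rewrite -(@expr_le1 _ 2).
have [a [b [ab hV hW]]] := sep V W VX WY.
(* Shifting by the midpoint [m] moves the spectrum on the complement into [[- r, r]] and the Ritz
   values to distance at least [rho] from 0. *)
pose m := (a + b) / 2; pose r := (b - a) / 2; pose rho := r + delta.
have r0 : 0 <= r by rewrite divr_ge0 // subr_ge0.
have rho0 : 0 < rho by rewrite ltr_wpDl.
have rrho : r < rho by rewrite ltrDl.
have VHV : (V ^t* *m H *m V) ^t* = V ^t* *m H *m V.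
  by rewrite !adjmxM trmxCK HH mulmxA.
have WHW : (W ^t* *m H *m W) ^t* = W ^t* *m H *m W.
  by rewrite !adjmxM trmxCK HH mulmxA.
have Lr : op_bound r (V ^t* *m H *m V - (m%:C%C)%:M).
  apply: op_bound_lambda => // i ik; have /andP[] := hV i ik.
  by rewrite /m /r ler_norml => h1 h2; apply/andP; split; lra.
have [i ik|K [KH Kr WK]] := @inverse_lambda _ _ m rho WHW rho0.
  rewrite /m /rho /r; have [h|h] := hW i ik.
    by rewrite ler0_norm; lra.
  by rewrite ger0_norm; lra.
(* Invariance removes this off-diagonal block, so that [V ^t* *m H] factors through [V ^t*]. *)
have VHQ : V ^t* *m H *m Q = 0.
  apply/matrixP => i j; have QjX : H *m col j Q \in mximage (S ^t*) X.
    apply: (subvP HX); apply/mem_mximage; exists (col j Q) => //.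
    by have := is_onb_memM 1%:M j QXS; rewrite mulmx1.
  have [x xE] := is_onb_mem _ QXS QjX.
  have : V ^t* *m (H *m col j Q) = 0.
    by rewrite xE mulmxA (onb_orthoc_mul QXS VX) mul0mx.
  rewrite colE !mulmxA -colE => E.
  have <- : col j (V ^t* *m H *m Q) i 0 = (V ^t* *m H *m Q) i j by rewrite mxE.
  by rewrite E !mxE.
have LH : (V ^t* *m H *m V - (m%:C%C)%:M) ^t* = V ^t* *m H *m V - (m%:C%C)%:M.
  rewrite adjmxB VHV tr_scalar_mx map_scalar_mx; congr (_ - _%:M).
  exact: conjC_real.
have VHm : V ^t* *m (H - (m%:C%C)%:M) = (V ^t* *m H *m V - (m%:C%C)%:M) *m V ^t*.
  rewrite mulmxBr mulmxBl -(mulmxA _ V) VV mulmxBr mulmx1 !mulmxA VHQ mul0mx subr0.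
  by rewrite mul_mx_scalar mul_scalar_mx.
have WKm : W ^t* *m (H - (m%:C%C)%:M) *m W *m K = 1%:M.
  rewrite mulmxBr (mulmxBl _ _ W) mul_mx_scalar -scalemxAl WY.1 scalemx1.
  exact: WK.
have [_] := tan_theta hN kp pd VX.1 WY.1 LH VHm WKm KH Lr Kr r0 rrho c0 WVVW.
rewrite residual_shift; last exact: WY.1.
rewrite /rho addrC addKr.
set t := rdiag _.
(* The angles are numbered from the smallest cosine, [c] from the largest; the norm ignores the
   reversal. *)
have -> : N (pad d (diag_tan (@principal_angle R d k X Y))) = N (pad d t).
  have hNk := pad_invariant_norm (leq_trans kp pd) hN.
  rewrite -(norm_rdiag_perm (perm rev_ord_inj)
    (fun i => Num.sqrt (1 - c i ^+ 2) / c i) hNk).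
  congr (N (pad d _)); apply: eq_rdiag => i /=; rewrite permE.
  rewrite /principal_angle /singular_value -/Xo -/Yo -McE; apply: tan_acos.
  by rewrite (le_trans _ (c0 (rev_ord i))) ?lerN10 // c1.
move=> /le_trans; apply.
have YmS := onb_mximage hS YT hYm.
(* The unitary change from the given orthonormal basis to [W]; the residual is multiplied by it. *)
pose E := (S ^t* *m Ym) ^t* *m W.
have WE : W = S ^t* *m Ym *m E.
  apply/matrixP => i j; have := is_onb_memM 1%:M j WY; rewrite mulmx1.
  move=> /(onb_proj YmS); rewrite colE !mulmxA -!colE -mulmxA => F.
  have <- : col j (S ^t* *m Ym *m E) i 0 = (S ^t* *m Ym *m E) i j by rewrite mxE.
  by rewrite F mxE.
have EE : E *m E ^t* = 1%:M.
  apply: mulmx1C; have := WY.1; rewrite {1}WE {1}WE adjmxM mulmxA.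
  by rewrite -(mulmxA _ _ (S ^t* *m Ym)) YmS.1 mulmx1.
rewrite {1}WE residual_mul_unitary //.
have := norm_pad_boundr (residual H (S ^t* *m Ym)) hN ler01 (leq_trans kp pd)
  (op_bound_coisometry EE).
by rewrite mul1r.
Qed.

(** [S *m S ^t*] fixes the columns of [Ym], so the Ritz matrix is the same in both coordinates. *)
Lemma residual_frame d k p (A : 'M[C]_d) (Y T : {vspace 'cV[C]_d})
    (S : 'M[C]_(d, p)) (Ym : 'M[C]_(d, k)) :
  is_onb S T -> (Y <= T)%VS -> is_onb Ym Y ->
  residual (S ^t* *m A *m S) (S ^t* *m Ym) = S ^t* *m residual A Ym.
Proof.
move=> hS YT hYm; have SY := frame_proj hS YT hYm.
have SY1 : S *m (S ^t* *m Ym) = Ym by rewrite mulmxA.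
have SY2 : Ym ^t* *m S *m S ^t* = Ym ^t*.
  by have := congr1 (fun M => M ^t*) SY; rewrite !adjmxM trmxCK mulmxA.
have E1 : S ^t* *m A *m S *m (S ^t* *m Ym) = S ^t* *m A *m Ym.
  by rewrite -!mulmxA SY1.
have E2 : (S ^t* *m Ym) ^t* *m (S ^t* *m A *m S) *m (S ^t* *m Ym) =
    Ym ^t* *m A *m Ym.
  by rewrite adjmxM trmxCK -!mulmxA SY1 !mulmxA SY2.
by rewrite /residual E2 E1 mulmxBr !mulmxA.
Qed.

End TanTheta.

Theorem theorem3p19 (R : realType) (d k p : nat) (A : 'M[R[i]]_d)
  (X Y : {vspace 'cV[R[i]]_d}) (Ym : 'M[R[i]]_(d, k)) (S : 'M[R[i]]_(d, p))
  (hA : A \is hermsymmx) (hX : \dim X = k) (hY : \dim Y = k)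
  (hYm : is_onb Ym Y) (hp : p = \dim (X + Y)) (hS : is_onb S (X + Y)%VS) :
  let RY := residual A Ym in
  let AXY := S ^t* *m A *m S in
  let XS := mximage (S ^t*) X in
  let YS := mximage (S ^t*) Y in
  let YmS := S ^t* *m Ym in
  (forall delta : R, 0 < delta -> DKN_separation k A X Y delta ->
     exists2 delta', delta <= delta' & DKN_separation k AXY XS YS delta')
  /\
  (forall delta' : R, 0 < delta' -> DKN_separation k AXY XS YS delta' ->
     forall N : 'M[R[i]]_d -> R, unitarily_invariant_norm N ->
       delta' * N (pad d (diag_tan (@principal_angle R d k X Y)))
         <= N (pad d (residual AXY YmS))
       /\ N (pad d (residual AXY YmS)) = N (pad d (orthoproj (X + Y) *m RY))).
Proof.
move=> RY AXY XS YS YmS.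
have XT : (X <= X + Y)%VS := addvSl X Y.
have YT : (Y <= X + Y)%VS := addvSr X Y.
have pd : (p <= d)%N.
  have <- : \dim {:'cV[R[i]]_d} = d by rewrite dimvf; apply: muln1.
  by rewrite hp dimvS // subvf.
split=> [delta _ sep | delta' delta0 sep N hN].
  by exists delta => //; apply: DKN_separation_frame hS XT YT sep.
split; first exact: DKN_tan_bound hS XT YT pd hX hY hYm delta0 sep hN.
rewrite (orthoprojE hS) /AXY /YmS (residual_frame A hS YT hYm) -/RY -mulmxA.
(* The projection is [S *m S ^t*]. The isometry [S] does not increase the norm, and neither does
   [S ^t*], which undoes it. *)
apply: le_anti; apply/andP; split; last first.
  have := norm_pad_boundl (S ^t* *m RY) hN ler01 pd (op_bound_isometry hS.1).
  by rewrite mul1r.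
have Sb : op_bound 1 (S ^t*) by apply: op_bound_coisometry; rewrite trmxCK hS.1.
have := norm_pad_boundl (S *m (S ^t* *m RY)) hN ler01 (leqnn d) Sb.
by rewrite mul1r (mulmxA (S ^t*)) hS.1 mul1mx.
Qed.
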